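(* The local ratio algorithm for Transverse Prize Collecting Vertex Cover described in the context is a $4.194$-approximation algorithm for the Transverse Prize Collecting Vertex Cover problem: on every instance with Hamiltonian $H$, it runs in polynomial time and outputs a description of a product state $\rho$ with $$\mathrm{Tr}[H\rho]\le 4.194\cdot\lambda_{\min}(H),$$ where $\lambda_{\min}(H)$ is the smallest eigenvalue (ground state energy) of $H$.
   Context: Qubits are indexed by the vertices of a graph. $Z=|0\rangle\langle 0|-|1\rangle\langle 1|$ is the Pauli $Z$ matrix; a subscript $i$ on an operator means it acts on qubit $i$ and as the identity elsewhere. Transverse Prize Collecting Vertex Cover: the input is a (finite, simple, undirected) graph $G=(V,E)$ and a Hamiltonian on $(\mathbb{C}^2)^{\otimes|V|}$ $$H=\sum_{i\in V}c_i\phi_i+\sum_{ij\in E}c_{ij}\frac{(I+Z_i)\otimes(I+Z_j)}{4},$$ where $\phi_i$ is a rank-1 projector on the $i$-th qubit with $\mathrm{Tr}[Z_i\phi_i]\le 0$ (trace over qubit $i$ only) and $c_i\ge 0$ for all $i\in V$, and $c_{ij}\ge 0$ for all $ij\in E$. The problem is to minimize $\mathrm{Tr}[H\rho]$ over all density matrices $\rho$ (no further constraints), so the optimal value is $\lambda_{\min}(H)$. Algorithm (the coefficients $c_i,c_{ij}$ below are those of the current, updated $H$): 1. For any $i\in V$ with $c_i=0$, set $\rho_i=|1\rangle\langle 1|$. 2. Choose an (arbitrary) edge $ij\in E$ with $\min\{c_i,c_j,c_{ij}\}>0$, and let $H_{ij}=\phi_i+\phi_j+\lambda\frac{(I+Z_i)\otimes(I+Z_j)}{4}$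 where $\lambda=\frac{2}{1-\mathrm{Tr}(Z_i\phi_i)}+\frac{2}{1-\mathrm{Tr}(Z_j\phi_j)}$ (each trace over the single qubit). 3. Update $H\to H-w_{ij}H_{ij}$ where $w_{ij}=\min\{c_i,c_j,c_{ij}/\lambda\}$. 4. Repeat from step 1 until no more edges are left to choose in step 2. 5. For any remaining $i$ with $c_i>0$, set $\rho_i=I-\phi_i$. Output: the product state $\rho=\bigotimes_i\rho_i$. *)

(* Defs.v *)
From mathcomp Require Export all_boot all_order all_algebra.
From mathcomp Require Export sesquilinear spectral reals complex.

Set Implicit Arguments.
Unset Strict Implicit.
Unset Printing Implicit Defensive.

Import Order.TTheory GRing.Theory Num.Theory.
Local Open Scope ring_scope.
Local Open Scope sesquilinear_scope.

Section Operators.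
Variable C : numClosedFieldType.

Definition rank1_projector n (A : 'M[C]_n) : Prop :=
  [/\ A \is hermsymmx, A *m A = A & \rank A = 1%N].

Definition is_density n (A : 'M[C]_n) : Prop :=
  [/\ A \is hermsymmx,
      forall v : 'rV[C]_n, 0 <= (v *m A *m v ^t*) 0 0
    & \tr A = 1].

Definition smallest_eigenvalue n (A : 'M[C]_n) (a : C) : Prop :=
  eigenvalue A a /\ forall b, eigenvalue A b -> a <= b.

Definition ket0bra0 : 'M[C]_2 := delta_mx 0 0.
Definition ket1bra1 : 'M[C]_2 := delta_mx 1 1.
Definition pauliZ : 'M[C]_2 := ket0bra0 - ket1bra1.

(* The computational basis of the qubits in V is indexed by bit assignments;
   matrices on (C^2)^{(x) V} are indexed through the enumeration of those. *)
Definition basis (V : finType) : finType := {ffun V -> 'I_2}.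

Definition tensor (V : finType) (A : V -> 'M[C]_2) : 'M[C]_#|basis V| :=
  \matrix_(s, t) \prod_(v : V)
    A v ((enum_val s : {ffun V -> 'I_2}) v) ((enum_val t : {ffun V -> 'I_2}) v).

Definition on_qubit (V : finType) (i : V) (A : 'M[C]_2) : 'M[C]_#|basis V| :=
  tensor (fun v => if v == i then A else 1%:M).

Definition on_qubits2 (V : finType) (i j : V) (A B : 'M[C]_2) :
    'M[C]_#|basis V| :=
  tensor (fun v => if v == i then A else if v == j then B else 1%:M).

End Operators.

(* The order of R[i] is the partial one: 0 <= x says that x is real and
   nonnegative, so the coefficients below are real although typed in R[i]. *)
Record instance (R : realType) (V : finType) := Instance {
  adj : rel V;
  adj_sym : symmetric adj;
  adj_irr : irreflexive adj;
  phi : V -> 'M[R[i]]_2;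
  phi_proj : forall i, rank1_projector (phi i);
  phi_trZ : forall i, \tr (pauliZ _ *m phi i) <= 0;
  cV : V -> R[i];
  cV_ge0 : forall i, 0 <= cV i;
  cE : V -> V -> R[i];
  cE_sym : forall i j, cE i j = cE j i;
  cE_ge0 : forall i j, adj i j -> 0 <= cE i j }.

Section Hamiltonian.
Variables (R : realType) (V : finType) (I : instance R V).

(* Each undirected edge appears exactly once, in one orientation. *)
Definition edges : seq (V * V) :=
  [seq e <- enum {: V * V} |
     adj I e.1 e.2 && (enum_rank e.1 < enum_rank e.2)%N].

Definition hamiltonian : 'M[R[i]]_#|basis V| :=
  \sum_(i : V) cV I i *: on_qubit i (phi I i) +
  \sum_(e <- edges) cE I e.1 e.2 *:
     (4%:R^-1 *: on_qubits2 e.1 e.2 (1%:M + pauliZ _) (1%:M + pauliZ _)).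

End Hamiltonian.

(* Cost model: a computation returns its value together with the log of its
   elementary steps.  Every read, write, arithmetic operation or comparison of
   numbers and every control step adds one entry, so that the size of the log
   is the running time.  The entry is the number read, written or computed, and
   0 for a step that yields no number. *)
Definition prog (C : Type) (A : Type) : Type := (A * seq C)%type.

Definition ret {C A : Type} (a : A) : prog C A := (a, [::]).
Definition bind (C A B : Type) (m : prog C A) (f : A -> prog C B) : prog C B :=
  ((f m.1).1, m.2 ++ (f m.1).2).

Notation "'let*' x ':=' m 'in' k" := (bind m (fun x => k))
  (at level 200, x name, m at level 100, k at level 200).

Section Primitives.
Variable C : numClosedFieldType.
Implicit Types x y : C.

Definition emit x : prog C C := (x, [:: x]).
Definition tick : prog C unit := (tt, [:: 0]).
Definition p_add x y := emit (x + y).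
Definition p_sub x y := emit (x - y).
Definition p_mul x y := emit (x * y).
Definition p_div x y := emit (x / y).
Definition p_is0 x : prog C bool := (x == 0, [:: 0]).
Definition p_le x y : prog C bool := (x <= y, [:: 0]).
Definition p_lt x y : prog C bool := (x < y, [:: 0]).

Definition p_min x y : prog C C :=
  let* b := p_le x y in ret (if b then x else y).

Definition p_mx (A : 'M[C]_2) : prog C 'M[C]_2 :=
  (A, [:: A 0 0; A 0 1; A 1 0; A 1 1]).

Definition p_read (T : finType) (a : {ffun T -> C}) (t : T) := emit (a t).

Definition p_write (T : finType) (a : {ffun T -> C}) (t : T) x :
    prog C {ffun T -> C} :=
  ([ffun u => if u == t then x else a u], [:: x]).

Definition p_write_mx (T : finType) (a : {ffun T -> option 'M[C]_2}) (t : T)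
    (A : 'M[C]_2) : prog C {ffun T -> option 'M[C]_2} :=
  let* B := p_mx A in ret [ffun u => if u == t then Some B else a u].

Fixpoint p_for (T S : Type) (r : seq T) (body : T -> S -> prog C S) (s : S) :
    prog C S :=
  if r is t :: r' then
    let* _ := tick in
    let* s' := body t s in
    p_for r' body s'
  else ret s.

End Primitives.

Arguments tick {C}.

Section Algorithm.
Variables (R : realType) (V : finType) (I : instance R V).
Local Notation C := (R[i] : numClosedFieldType).

Record state := State {
  curV : {ffun V -> C};
  curE : {ffun V * V -> C};   (* only the entries at edges I are used *)
  out : {ffun V -> option 'M[C]_2} }.

Definition init : state :=
  State [ffun i => cV I i] [ffun e => cE I e.1 e.2] [ffun=> None].

Definition step1 (s : state) : prog C state :=
  p_for (enum V) (fun i s =>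
    let* c := p_read (curV s) i in
    let* b := p_is0 c in
    if b then
      let* r := p_write_mx (out s) i (ket1bra1 C) in
      ret (State (curV s) (curE s) r)
    else ret s) s.

Definition eligible (s : state) : prog C (seq (V * V)) :=
  p_for (edges I) (fun e l =>
    let* ci := p_read (curV s) e.1 in
    let* cj := p_read (curV s) e.2 in
    let* cij := p_read (curE s) e in
    let* m := p_min ci cj in
    let* m' := p_min m cij in
    let* b := p_lt 0 m' in
    ret (if b then e :: l else l)) [::].

(* Tr (Z phi) = phi_00 - phi_11, see trZ_progE. *)
Definition trZ_prog (i : V) : prog C C :=
  let* a := emit (phi I i 0 0) in
  let* b := emit (phi I i 1 1) in
  p_sub a b.

Definition lambda_prog (i j : V) : prog C C :=
  let* zi := trZ_prog i in
  let* di := p_sub 1 zi in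
  let* ti := p_div 2%:R di in
  let* zj := trZ_prog j in
  let* dj := p_sub 1 zj in
  let* tj := p_div 2%:R dj in
  p_add ti tj.

(* The update H -> H - w H_ij, on coefficients. *)
Definition step3 (e : V * V) (s : state) : prog C state :=
  let* l := lambda_prog e.1 e.2 in
  let* ci := p_read (curV s) e.1 in
  let* cj := p_read (curV s) e.2 in
  let* cij := p_read (curE s) e in
  let* q := p_div cij l in
  let* m := p_min ci cj in
  let* w := p_min m q in
  let* ci' := p_sub ci w in
  let* a := p_write (curV s) e.1 ci' in
  let* cj' := p_sub cj w in
  let* a' := p_write a e.2 cj' in
  let* wl := p_mul w l in
  let* cij' := p_sub cij wl in
  let* b := p_write (curE s) e cij' in
  ret (State a' b (out s)).

Definition step5 (s : state) : prog C state :=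
  p_for (enum V) (fun i s =>
    let* c := p_read (curV s) i in
    let* b := p_lt 0 c in
    if b then
      let* A := p_mx (phi I i) in
      let* r := p_write_mx (out s) i (1%:M - A) in
      ret (State (curV s) (curE s) r)
    else ret s) s.

(* The arbitrary choice of an edge: in round k, the entry of index
   sel k modulo the number of eligible edges is taken.  Every sequence of
   choices arises from some sel.  The fuel only makes the loop structurally
   recursive: None means that it was exhausted. *)
Fixpoint loop (sel : nat -> nat) (fuel k : nat) (s : state) :
    prog C (option {ffun V -> option 'M[C]_2}) :=
  if fuel is fuel'.+1 then
    let* s1 := step1 s in
    let* l := eligible s1 in
    if l is e :: _ then
      let* _ := tick in
      let* s3 := step3 (nth e l (sel k %% size l)%N) s1 in
      loop sel fuel' k.+1 s3
    else
      let* s5 := step5 s1 in ret (Some (out s5))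
  else ret None.

(* The run with choices sel halts with every rho_i assigned, and has the
   given log. *)
Definition run (sel : nat -> nat) (rho : V -> 'M[C]_2) (log : seq C) : Prop :=
  exists fuel, loop sel fuel 0 init = (Some [ffun i => Some (rho i)], log).

Lemma trZ_progE i : (trZ_prog i).1 = \tr (pauliZ C *m phi I i).
Proof.
rewrite /trZ_prog /= /pauliZ mulmxBl linearB /= /mxtrace.
rewrite !big_ord_recl !big_ord0 !mxE !big_ord_recl !big_ord0 !mxE /=.
rewrite !(mul0r, mul1r, addr0, add0r).
by congr (_ - phi I i _ _); apply/val_inj.
Qed.

Lemma lambda_progE i j : (lambda_prog i j).1 =
  2%:R / (1 - \tr (pauliZ C *m phi I i)) +
  2%:R / (1 - \tr (pauliZ C *m phi I j)).
Proof. by rewrite -!trZ_progE. Qed.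

End Algorithm.

(* x is a Gaussian rational written with integers of at most b bits.  Polynomial
   time on real data means polynomially many elementary steps; on rational data
   the numbers in the log must also have polynomial bit length. *)
Definition bits_le (C : numClosedFieldType) (b : nat) (x : C) : Prop :=
  exists (p q : int) (d : nat),
    [/\ (`|p| < 2 ^ b)%N, (`|q| < 2 ^ b)%N, (0 < d < 2 ^ b)%N
      & x = (p%:~R + 'i * q%:~R) / d%:R].

Definition input_bits_le (R : realType) (V : finType) (I : instance R V)
    (b : nat) : Prop :=
  [/\ forall i, bits_le b (cV I i),
      forall i j, adj I i j -> bits_le b (cE I i j)
    & forall i k l, bits_le b (phi I i k l)].

(* Main.v *)
Require Import Defs.
From mathcomp Require Import zify ring lra.
Set Implicit Arguments.
Unset Strict Implicit.
Unset Printing Implicit Defensive.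
Import Order.TTheory GRing.Theory Num.Theory.
Local Open Scope ring_scope.
Local Open Scope sesquilinear_scope.

(* Put x_i = <1|phi_i|1>, which lies in [1/2, 1].  Any product of states from
   {|1><1|, I - phi_i} has energy at most x_i + x_j on H_ij, and the smallest
   eigenvalue of H_ij is at least (x_i + x_j) / 4.194: splitting along the
   spectral projections of phi_i + phi_j turns this into a secular inequality
   in x_i and x_j, nearly tight at x_i = x_j = 1/2.  Summing over the rounds
   with weights w_ij gives the ratio, because the final remainder is positive
   semidefinite and has zero energy in the output.  Each round annihilates a
   coefficient, which bounds the number of rounds. *)

(** * Norms and a rank-one perturbation bound *)

(** For a rank-one projector N of weight p_k on P_k, the secular equation puts mu below the spectrum
    of P1 + 2 P2 + L N when p1/(1 - mu) + p2/(2 - mu) <= p0/mu - 1/L; [K] is the inverse of the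
    right-hand side. On all the qubits together the edge projector no longer has rank one, so the
    argument rests only on compression identities such as [N *m P1 *m N = p1 *: N], which survive
    tensoring with the identity. At x_i = x_j = 1/2 the secular inequality for a ratio r > 1 becomes
    2 r^3 - 10 r^2 + 7 r - 1 >= 0. The largest root of this cubic is about 4.1939, which rounds up
    to 4.194. Bit lengths are a separate obstacle: estimating each subtraction on its own would
    double the length in every round. A single denominator, fixed before the first round, serves all
    rounds instead. *)

Section Dot.
Variable C : numClosedFieldType.

Definition dot n (u v : 'rV[C]_n) : C := (u *m v ^t*) 0 0.

Section Fixed.
Variable n : nat.
Implicit Types (u v w : 'rV[C]_n) (A B : 'M[C]_n) (a : C).

Lemma dotE u v : dot u v = \sum_j u 0 j * (v 0 j)^*.
Proof. by rewrite /dot mxE; apply: eq_bigr => j _; rewrite !mxE. Qed.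

Lemma dotDl u v w : dot (u + v) w = dot u w + dot v w.
Proof. by rewrite /dot mulmxDl mxE. Qed.

Lemma dotZl a u w : dot (a *: u) w = a * dot u w.
Proof. by rewrite /dot -scalemxAl mxE. Qed.

Lemma dotC u v : dot v u = (dot u v)^*.
Proof.
rewrite !dotE rmorph_sum; apply: eq_bigr => j _.
by rewrite rmorphM /= conjCK mulrC.
Qed.

Lemma dotDr u v w : dot u (v + w) = dot u v + dot u w.
Proof. by rewrite dotC dotDl rmorphD /= -!dotC. Qed.

Lemma dotZr a u w : dot u (a *: w) = a^* * dot u w.
Proof. by rewrite dotC dotZl rmorphM /= -dotC. Qed.

Lemma dot_ge0 u : 0 <= dot u u.
Proof. by rewrite dotE sumr_ge0 // => j _; rewrite mul_conjC_ge0. Qed.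

Lemma dot_gt0 u : u != 0 -> 0 < dot u u.
Proof.
move=> u0; rewrite lt_neqAle dot_ge0 andbT eq_sym.
apply: contraNneq u0 => /eqP.
rewrite dotE psumr_eq0 => [/allP u0|j _]; last by rewrite mul_conjC_ge0.
apply/eqP/rowP => j; rewrite mxE; apply/eqP.
by have := u0 j (mem_index_enum j); rewrite mul_conjC_eq0.
Qed.

Lemma dot_mulmxr u v A : A ^t* = A -> dot u (v *m A) = dot (u *m A) v.
Proof. by move=> hA; rewrite /dot trmx_mul map_mxM /= hA mulmxA. Qed.

Lemma adj_sum (J : Type) (l : seq J) (F : J -> 'M[C]_n) :
  (\sum_(j <- l) F j) ^t* = \sum_(j <- l) (F j) ^t*.
Proof.
apply/matrixP => i j; rewrite !mxE !summxE rmorph_sum.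
by apply: eq_bigr => k _; rewrite !mxE.
Qed.

Lemma adj_scale a A : 0 <= a -> A ^t* = A -> (a *: A) ^t* = a *: A.
Proof.
move=> a0 hA; apply/matrixP => i j; rewrite -[in RHS]hA !mxE rmorphM /=.
by rewrite geC0_conj.
Qed.

Lemma proj_form_ge0 v A : A ^t* = A -> A *m A = A -> 0 <= dot (v *m A) v.
Proof. by move=> hA AA; rewrite -AA mulmxA -dot_mulmxr // dot_ge0. Qed.

(* Write v = a + e1 + e2 along P0, P1, P2, and vN = aN + m.  Cauchy-Schwarz
   bounds (1-mu)|e1|^2 + (2-mu)|e2|^2 below by K |m|^2, and the remaining form
   K |m|^2 + L |aN + m|^2 - mu |a|^2 is a perfect square by the choice of mu. *)
Lemma rank1_perturbation_bound (P0 P1 P2 N : 'M[C]_n) (p0 p1 p2 L K mu : C) :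
    [/\ P0 ^t* = P0, P1 ^t* = P1, P2 ^t* = P2 & N ^t* = N] ->
    [/\ P0 *m P0 = P0, P1 *m P1 = P1, P2 *m P2 = P2 & N *m N = N] ->
    P1 *m P2 = 0 -> P2 *m P1 = 0 -> P0 + P1 + P2 = 1%:M ->
    P0 *m N *m P0 = p0 *: P0 ->
    N *m P1 *m N = p1 *: N -> N *m P2 *m N = p2 *: N ->
    0 < L -> 0 < K -> mu < 1 -> mu * (L + K) = p0 * L * K ->
    K * (p1 / (1 - mu) + p2 / (2%:R - mu)) <= 1 ->
  forall v, mu * dot v v <= dot (v *m (P1 + 2%:R *: P2 + L *: N)) v.
Proof.
case=> h0 h1 h2 hN [i0 i1 i2 iN] o12 o21 sum1 c0 c1 c2 L0 K0 mu1 muE kap v.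
have mu2 : 0 < 2%:R - mu by rewrite subr_gt0 (lt_trans mu1) // ltr1n.
have {}mu1 : 0 < 1 - mu by rewrite subr_gt0.
set a := v *m P0; set e1 := v *m P1; set e2 := v *m P2.
set m := (e1 + e2) *m N.
have ve : v = a + e1 + e2 by rewrite -[LHS]mulmx1 -sum1 !mulmxDr.
have vN : v *m N = a *m N + m by rewrite {1}ve -addrA mulmxDl.
have formE B : B ^t* = B -> B *m B = B -> dot (v *m B) (v *m B) = dot (v *m B) v.
  by move=> hB iB; rewrite dot_mulmxr // -mulmxA iB.
have E1 : dot e1 e1 = dot e1 v by exact: formE.
have E2 : dot e2 e2 = dot e2 v by exact: formE.
have E0 : dot a a = dot a v by exact: formE.
have qaN : dot (a *m N) (a *m N) = p0 * dot a a.
  rewrite dot_mulmxr // -mulmxA iN dot_mulmxr // -!mulmxA (mulmxA P0) c0.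
  by rewrite -scalemxAr dotZl E0.
have qm : dot m m = dot m (e1 + e2) by rewrite {2}/m dot_mulmxr // -mulmxA iN.
have qmP B p : B ^t* = B -> B *m B = B -> N *m B *m N = p *: N ->
    dot (m *m B) (m *m B) = p * dot m m.
  move=> hB iB cB; rewrite dot_mulmxr // -mulmxA iB {2}/m dot_mulmxr //.
  by rewrite {1}/m -!mulmxA (mulmxA N) cB -scalemxAr dotZl qm.
have em1 : dot e1 (m *m P1) = dot e1 m by rewrite dot_mulmxr // -mulmxA i1.
have em2 : dot e2 (m *m P2) = dot e2 m by rewrite dot_mulmxr // -mulmxA i2.
have me1 : dot (m *m P1) e1 = dot m e1 by rewrite dotC em1 -dotC.
have me2 : dot (m *m P2) e2 = dot m e2 by rewrite dotC em2 -dotC.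
have sme : dot m e2 = dot m m - dot m e1 by rewrite qm dotDr addrC addKr.
have sem : dot e2 m = dot m m - dot e1 m.
  by rewrite dotC sme rmorphB /= -!dotC.
have cj x : 0 < x -> x^* = x by move=> x0; rewrite geC0_conj // ltW.
(* Chosen so that, after weighting by 1 - mu and 2 - mu, the cross terms of both squares carry the
   factor [K] and add up to 2 K |m|^2. *)
pose k1 := K / (1 - mu); pose k2 := K / (2%:R - mu).
have q1 : 0 <= dot e1 e1 - k1 * (dot e1 m + dot m e1) + k1 ^+ 2 * (p1 * dot m m).
  have := dot_ge0 (e1 + (- k1) *: (m *m P1)).
  rewrite dotDl !dotDr !dotZl !dotZr (qmP _ _ h1 i1 c1) em1 me1.
  rewrite rmorphN /= cj ?divr_gt0 //; congr (_ <= _); ring.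
have q2 : 0 <= dot e2 e2 - k2 * (dot e2 m + dot m e2) + k2 ^+ 2 * (p2 * dot m m).
  have := dot_ge0 (e2 + (- k2) *: (m *m P2)).
  rewrite dotDl !dotDr !dotZl !dotZr (qmP _ _ h2 i2 c2) em2 me2.
  rewrite rmorphN /= cj ?divr_gt0 //; congr (_ <= _); ring.
pose X := dot (a *m N) m + dot m (a *m N).
have LK0 : 0 < L + K by rewrite addr_gt0.
have q3 : 0 <= L ^+ 2 * (p0 * dot a a) + L * (L + K) * X
               + (L + K) ^+ 2 * dot m m.
  have := dot_ge0 (L *: (a *m N) + (L + K) *: m).
  rewrite dotDl !dotDr !dotZl !dotZr qaN !cj // /X; congr (_ <= _); ring.
have q4 : 0 <= K * (1 - K * (p1 / (1 - mu) + p2 / (2%:R - mu))) * dot m m.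
  by rewrite !mulr_ge0 ?dot_ge0 ?subr_ge0 // ltW.
have -> : dot (v *m (P1 + 2%:R *: P2 + L *: N)) v
    = dot e1 e1 + 2%:R * dot e2 e2 + L * (p0 * dot a a + X + dot m m).
  rewrite !mulmxDr -!scalemxAr !dotDl !dotZl -E1 -E2; congr (_ + _ * _).
  rewrite -formE // vN dotDl !dotDr qaN /X; ring.
have -> : dot v v = dot a a + dot e1 e1 + dot e2 e2.
  by rewrite {1}ve !dotDl -E0 -E1 -E2.
(* A sum-of-squares certificate: this nonnegative combination equals the difference of the two
   sides, which [field] confirms. *)
have := addr_ge0 (addr_ge0 (mulr_ge0 (ltW mu1) q1) (mulr_ge0 (ltW mu2) q2))
   (addr_ge0 q4 (divr_ge0 q3 (ltW LK0))).
move=> cert; rewrite -subr_ge0; move: cert; congr (_ <= _).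
have -> : p0 = mu * (L + K) / (L * K).
  by rewrite muE -(mulrA p0) mulfK // mulf_neq0 ?gt_eqF.
rewrite /k1 /k2 sme sem; field.
by rewrite !gt_eqF.
Qed.
End Fixed.
End Dot.

(** * The secular inequality *)

Lemma secular_bound (R : realFieldType) (x y r : R) : r = 4194%:R / 1000%:R ->
  1 <= 2%:R * x -> x <= 1 -> 1 <= 2%:R * y -> y <= 1 ->
  (x + y) / (x * y * (r - 1)) *
    (((1 - x) * y + x * (1 - y)) / (1 - (x + y) / r) +
     (1 - x) * (1 - y) / (2%:R - (x + y) / r)) <= 1.
Proof.
move=> rE x0 x1 y0 y1; have {rE} -> : r = 2097%:R / 500%:R by rewrite rE; field.
have xy0 : 0 < x * y by rewrite mulr_gt0 //; lra.
have t0 : 0 < 2097%:R - 500%:R * (x + y) by lra.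
have u0 : 0 < 4194%:R - 500%:R * (x + y) by lra.
rewrite -subr_ge0.
(* Expanded, this is 4 x y >= 2 (x + y) - 1, with equality when x or y is 1/2. *)
have e0 : 0 <= (2%:R * x - 1) * (2%:R * y - 1) by rewrite mulr_ge0 // subr_ge0.
(* Denominators are cleared using r = 2097/500 and r - 1 = 1597/500. *)
suff : 0 <= (1597%:R * (x * y) * (2097%:R - 500%:R * (x + y)) * (4194%:R - 500%:R * (x + y))
   - 500%:R * (x + y) * 2097%:R * (((1 - x) * y + x * (1 - y)) * (4194%:R - 500%:R * (x + y)) +
       (1 - x) * (1 - y) * (2097%:R - 500%:R * (x + y)))) /
   (1597%:R * (x * y) * (2097%:R - 500%:R * (x + y)) * (4194%:R - 500%:R * (x + y))).
  congr (_ <= _); field.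
  by apply/and4P; split; rewrite gt_eqF //; lra.
apply: divr_ge0; last by rewrite ltW // !(pmulr_lgt0 _ t0, pmulr_lgt0 _ u0, pmulr_lgt0 _ xy0) ltr0n.
have -> : (1 - x) * y + x * (1 - y) = x + y - 2%:R * (x * y) by ring.
have -> : (1 - x) * (1 - y) = 1 - (x + y) + x * y by ring.
set s := x + y; pose p := x * y.
rewrite -/p -/s in xy0 t0 u0 *.
have s1 : 1 <= s by rewrite /s; lra.
have s2 : s <= 2%:R by rewrite /s; lra.
have {e0} [q q0 pE] : exists2 q : R, 0 <= q & p = (2%:R * s - 1) / 4%:R + q.
  exists ((2%:R * x - 1) * (2%:R * y - 1) / 4%:R); first by rewrite divr_ge0.
  by rewrite /p /s; field.
(* For fixed s = x + y the claim is linear and increasing in p = x y, and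
   p >= (2 s - 1) / 4; there it is a cubic inequality in s. *)
rewrite pE; clearbody s; clear -s1 s2 q0.
have slope : 0 <= 1597%:R * (2097%:R - 500%:R * s) * (4194%:R - 500%:R * s)
   + 500%:R * s * 2097%:R * (2%:R * (4194%:R - 500%:R * s) - (2097%:R - 500%:R * s)).
  have h0 : 0 <= s - 1 by rewrite subr_ge0.
  have h1 : 0 <= 2%:R - s by rewrite subr_ge0.
  (* Products of the bounds 1 <= s <= 2, up to degree three, are the hints given to [nra]. *)
  have hh := mulr_ge0 h0 h1; have hhh := mulr_ge0 h0 hh.
  nra.
have base : 0 <= 1597%:R * ((2%:R * s - 1) / 4%:R) * (2097%:R - 500%:R * s) * (4194%:R - 500%:R * s)
   - 500%:R * s * 2097%:R * ((s - (2%:R * s - 1) / 2%:R) * (4194%:R - 500%:R * s) +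
       (1 - s + (2%:R * s - 1) / 4%:R) * (2097%:R - 500%:R * s)).
  have h0 : 0 <= s - 1 by rewrite subr_ge0.
  have h1 : 0 <= 2%:R - s by rewrite subr_ge0.
  have hh := mulr_ge0 h0 h1; have hhh := mulr_ge0 h0 hh.
  nra.
have := addr_ge0 base (mulr_ge0 q0 slope); by congr (_ <= _); field.
Qed.

(** The polynomial argument needs a totally ordered field, whereas the energies live in [R[i]]; an
    order-reflecting embedding carries the inequality over. *)
Lemma secular_bound_morph (R : realFieldType) (C : numFieldType)
    (f : {rmorphism R -> C}) (fle : {mono f : a b / a <= b})
    (x y : R) (r := 4194%:R / 1000%:R : C) :
  1 <= 2%:R * f x -> f x <= 1 -> 1 <= 2%:R * f y -> f y <= 1 ->
  (f x + f y) / (f x * f y * (r - 1)) *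
    (((1 - f x) * f y + f x * (1 - f y)) / (1 - (f x + f y) / r) +
     (1 - f x) * (1 - f y) / (2%:R - (f x + f y) / r)) <= 1.
Proof.
have ge1 z : (1 <= 2%:R * f z) = (1 <= 2%:R * z).
  by rewrite -fle rmorphM /= rmorph_nat rmorph1.
have le1 z : (f z <= 1) = (z <= 1) by rewrite -fle rmorph1.
rewrite !ge1 !le1 => x0 x1 y0 y1.
have : f (4194%:R / 1000%:R) = r by rewrite fmorph_div !rmorph_nat.
have := secular_bound erefl x0 x1 y0 y1.
move: r (_ / _) => {}r q; rewrite -fle => bnd rE.
have f2 : f 2%:R = 2%:R by rewrite rmorph_nat.
by move: bnd; congr (_ <= _);
  rewrite !(rmorphM f, fmorphV f, rmorphB f, rmorphD f, f2, rmorph1 f, rE).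
Qed.

(** In the partial order of [R[i]], z <= 1 already forces z to be real, so x and y come from [R]. *)
Lemma secular_boundC (R : realType) (x y : R[i]) (r := 4194%:R / 1000%:R : R[i]) :
  1 <= 2%:R * x -> x <= 1 -> 1 <= 2%:R * y -> y <= 1 ->
  (x + y) / (x * y * (r - 1)) *
    (((1 - x) * y + x * (1 - y)) / (1 - (x + y) / r) +
     (1 - x) * (1 - y) / (2%:R - (x + y) / r)) <= 1.
Proof.
move=> x0 x1 y0 y1.
have realE (z : R[i]) : z <= 1 -> z = real_complex R (complex.Re z).
  by move=> z1; rewrite [RHS]RRe_real // (ler_real z1) real1.
have xE := realE _ x1; have yE := realE _ y1.
move: xE yE x0 x1 y0 y1.
move: (complex.Re x) (complex.Re y) => a b -> ->.
by apply: secular_bound_morph; exact: lecR.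
Qed.

(** * Qubit projectors and tensor products *)

Lemma ord2P (i : 'I_2) : i = 0 \/ i = 1.
Proof. by case: i => [[|[|//]] lti]; [left|right]; apply/val_inj. Qed.

Section Qubit.
Variable C : numClosedFieldType.
Implicit Types A B : 'M[C]_2.

Lemma mx2P A B : A 0 0 = B 0 0 -> A 0 1 = B 0 1 -> A 1 0 = B 1 0 ->
  A 1 1 = B 1 1 -> A = B.
Proof.
move=> *; apply/matrixP => i j.
by case: (ord2P i) => ->; case: (ord2P j) => ->.
Qed.

Lemma sum2E (F : 'I_2 -> C) : \sum_i F i = F 0 + F 1.
Proof.
rewrite !big_ord_recl big_ord0 addr0; congr (_ + F _); exact/val_inj.
Qed.

Lemma mulmx2E A B i j : (A *m B) i j = A i 0 * B 0 j + A i 1 * B 1 j.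
Proof. by rewrite mxE sum2E. Qed.

Lemma mxtrace2E A : \tr A = A 0 0 + A 1 1.
Proof. exact: sum2E. Qed.

Lemma ket1E i j : ket1bra1 C i j = ((i == 1) && (j == 1))%:R.
Proof. by rewrite mxE. Qed.

Lemma ket0_adj : (ket0bra0 C) ^t* = ket0bra0 C.
Proof. by apply/matrixP => i j; rewrite !mxE conjC_nat andbC. Qed.

Lemma ket0_idem : ket0bra0 C *m ket0bra0 C = ket0bra0 C.
Proof. by rewrite mul_delta_mx. Qed.

Lemma ket1_adj : (ket1bra1 C) ^t* = ket1bra1 C.
Proof. by apply/matrixP => i j; rewrite !mxE conjC_nat andbC. Qed.

Lemma ket1_idem : ket1bra1 C *m ket1bra1 C = ket1bra1 C.
Proof. by rewrite mul_delta_mx. Qed.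

Lemma add1_pauliZ : 1%:M + pauliZ C = 2%:R *: ket0bra0 C.
Proof. by apply: mx2P; rewrite !mxE /=; ring. Qed.

Lemma ket0_compress A : ket0bra0 C *m A *m ket0bra0 C = A 0 0 *: ket0bra0 C.
Proof. by apply: mx2P; rewrite !mulmx2E !mxE /=; ring. Qed.

Lemma is_density_proj n (A : 'M[C]_n) :
  A ^t* = A -> A *m A = A -> \tr A = 1 -> is_density A.
Proof.
move=> hA iA tA; split=> //.
  by apply/is_hermitianmxP; rewrite expr0 scale1r hA.
by move=> v; apply: proj_form_ge0.
Qed.

Section Projector.
Variable A : 'M[C]_2.
Hypothesis prA : rank1_projector A.

Lemma proj_adj : A ^t* = A.
Proof.
by case: prA => /is_hermitianmxP; rewrite expr0 scale1r => <-.
Qed.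

Lemma proj_idem : A *m A = A. Proof. by case: prA. Qed.

Lemma projC_idem : (1%:M - A) *m (1%:M - A) = 1%:M - A.
Proof. by rewrite mulmxBl !mulmxBr !mul1mx mulmx1 proj_idem subrr subr0. Qed.

Lemma projC_adj : (1%:M - A) ^t* = 1%:M - A.
Proof.
rewrite linearB /= trmx1 -[in RHS]proj_adj.
by apply/matrixP => i j; rewrite !mxE rmorphB /= conjC_nat.
Qed.

Lemma proj_entries (i j : 'I_2) : A i j = A i 0 * A 0 j + A i 1 * A 1 j.
Proof. by rewrite -mulmx2E proj_idem. Qed.

(** Off the diagonal, A^2 = A says that each entry equals itself times the trace. If the trace is
    not 1, then A is diagonal with entries 0 or 1; the rank excludes 0 and the identity, and the
    other two cases have trace 1. *)
Lemma proj_tr : A 0 0 + A 1 1 = 1.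
Proof.
have nA0 : A <> 0 by case: prA => _ _ + A0; rewrite A0 mxrank0.
have nA1 : A <> 1%:M by case: prA => _ _ + A1; rewrite A1 mxrank1.
have e00 := proj_entries 0 0; have e01 := proj_entries 0 1.
have e10 := proj_entries 1 0; have e11 := proj_entries 1 1.
have [//|/eqP nt] := A 0 0 + A 1 1 =P 1; exfalso.
have nt' : A 0 0 + A 1 1 - 1 != 0 by rewrite subr_eq0.
have b0 : A 0 1 = 0.
  apply/eqP; rewrite -(mulIr_eq0 _ (mulIf nt')); apply/eqP.
  by rewrite mulrBr mulrDr mulr1 [X in _ - X]e01; ring.
have c0 : A 1 0 = 0.
  apply/eqP; rewrite -(mulIr_eq0 _ (mulIf nt')); apply/eqP.
  by rewrite mulrBr mulrDr mulr1 [X in _ - X]e10; ring.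
have z01 (x : C) : x = x * x -> x = 0 \/ x = 1.
  move=> xx; have /eqP : x * (x - 1) = 0 by rewrite mulrBr mulr1 -xx subrr.
  by rewrite mulf_eq0 subr_eq0 => /orP[] /eqP; [left|right].
move: e00 e11; rewrite b0 c0 !mul0r addr0 add0r => /z01 e00 /z01 e11.
case: e00 e11 nt => e00 [] e11; rewrite e00 e11 ?addr0 ?add0r ?eqxx // => _.
  by apply: nA0; apply: mx2P; rewrite ?e00 ?e11 ?b0 ?c0 !mxE.
by apply: nA1; apply: mx2P; rewrite ?e00 ?e11 ?b0 ?c0 !mxE.
Qed.

Lemma proj11E : A 1 1 = 1 - A 0 0.
Proof. by rewrite -proj_tr addrC addKr. Qed.

Lemma proj_conj i j : (A i j)^* = A j i.
Proof. by rewrite -[in RHS]proj_adj !mxE. Qed.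

Lemma proj_diag_ge0 i : 0 <= A i i.
Proof.
have -> : A i i = A i 0 * (A i 0)^* + A i 1 * (A i 1)^*.
  by rewrite !proj_conj -proj_entries.
by rewrite addr_ge0 // mul_conjC_ge0.
Qed.

Lemma proj_det : A 0 1 * A 1 0 = A 0 0 * A 1 1.
Proof.
have := proj_entries 0 0; rewrite proj11E.
by move=> /(canLR (addKr _)) <-; ring.
Qed.

(** A rank-one projector Q satisfies Q |0><0| Q = <0|Q|0> Q; here <0|Q|0> = 1 - <0|A|0> =
    <1|A|1>. *)
Lemma projC_compress_ket0 :
  (1%:M - A) *m ket0bra0 C *m (1%:M - A) = A 1 1 *: (1%:M - A).
Proof.
have a1 := proj11E.
have dt : A 0 1 * A 1 0 = A 0 0 * (1 - A 0 0) by rewrite proj_det a1.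
by apply: mx2P; rewrite !mulmx2E !mxE /=; ring: dt a1.
Qed.

Lemma tr_proj : \tr A = 1. Proof. by rewrite mxtrace2E proj_tr. Qed.

Lemma tr_projC : \tr (1%:M - A) = 1.
Proof. by rewrite raddfB /= tr_proj mxtrace1; ring. Qed.

Lemma tr_ket1 : \tr (ket1bra1 C) = 1.
Proof. by rewrite mxtrace2E !mxE add0r. Qed.

Lemma tr_proj_ket1 : \tr (A *m ket1bra1 C) = A 1 1.
Proof. by rewrite mxtrace2E !mulmx2E !mxE /=; ring. Qed.

Lemma tr_proj_projC : \tr (A *m (1%:M - A)) = 0.
Proof. by rewrite mulmxBr mulmx1 proj_idem subrr linear0. Qed.

Lemma tr_ket0_ket1 : \tr (ket0bra0 C *m ket1bra1 C) = 0.
Proof. by rewrite mul_delta_mx_0 // linear0. Qed.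

Lemma tr_ket0_projC : \tr (ket0bra0 C *m (1%:M - A)) = A 1 1.
Proof.
have a1 := proj11E; rewrite mxtrace2E !mulmx2E !mxE /=.
by ring: a1.
Qed.

End Projector.
End Qubit.

Section Tensor.
Variables (C : numClosedFieldType) (V : finType).
Implicit Types (f g : V -> 'M[C]_2) (A B : 'M[C]_2) (i j : V).

Lemma sum_basis (F : {ffun V -> 'I_2} -> C) :
  \sum_(s < #|basis V|) F (enum_val s) = \sum_s F s.
Proof. by rewrite [RHS](reindex _ (onW_bij _ (enum_val_bij _))). Qed.

(** Entrywise this is distributivity: a product over qubits of sums over one bit is a sum over bit
    assignments. *)
Lemma tensorM f g : tensor f *m tensor g = tensor (fun v => f v *m g v).
Proof.
apply/matrixP => s u; rewrite !mxE.
pose F v k := f v ((enum_val s : {ffun V -> 'I_2}) v) k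
  * g v k ((enum_val u : {ffun V -> 'I_2}) v).
transitivity (\prod_v \sum_k F v k); last first.
  by apply: eq_bigr => v _; rewrite mxE.
rewrite bigA_distr_bigA -(sum_basis (fun t => \prod_v F v (t v))).
by apply: eq_bigr => t _; rewrite !mxE big_split.
Qed.

Lemma tr_tensor f : \tr (tensor f) = \prod_v \tr (f v).
Proof.
rewrite [RHS]bigA_distr_bigA -(sum_basis (fun t => \prod_v f v (t v) (t v))).
by apply: eq_bigr => s _; rewrite mxE.
Qed.

Lemma eq_tensor f g : f =1 g -> tensor f = tensor g.
Proof.
by move=> fg; apply/matrixP => s t; rewrite !mxE; apply: eq_bigr => v _; rewrite fg.
Qed.

Lemma tensor1 : tensor (fun _ : V => 1%:M : 'M[C]_2) = 1%:M.
Proof.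
apply/matrixP => s t; rewrite !mxE.
have [->|nst] := eqVneq s t; first by rewrite big1 // => v _; rewrite mxE eqxx.
have /eqfunP/forallPn[v nv] : ~ (enum_val s : {ffun V -> 'I_2}) =1 enum_val t.
  by move=> /ffunP/enum_val_inj/eqP; apply/negP.
by rewrite (bigD1 v) //= mxE (negbTE nv) mul0r.
Qed.

Lemma tensor_adj f : (tensor f) ^t* = tensor (fun v => (f v) ^t*).
Proof.
apply/matrixP => s t; rewrite !mxE rmorph_prod; apply: eq_bigr => v _.
by rewrite !mxE.
Qed.

(** Isolating the factor at [i] makes linearity in [A] visible. *)
Lemma on_qubitE i A : on_qubit i A = \matrix_(s, t)
  (A ((enum_val s : {ffun V -> 'I_2}) i) ((enum_val t : {ffun V -> 'I_2}) i)
   * \prod_(v | v != i) ((enum_val s : {ffun V -> 'I_2}) v ==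
                         (enum_val t : {ffun V -> 'I_2}) v)%:R).
Proof.
apply/matrixP => s t; rewrite !mxE (bigD1 i) //= eqxx; congr (_ * _).
by apply: eq_bigr => v /negbTE ->; rewrite mxE.
Qed.

Lemma on_qubitD i A B : on_qubit i (A + B) = on_qubit i A + on_qubit i B.
Proof. by apply/matrixP => s t; rewrite !on_qubitE !mxE mulrDl. Qed.

Lemma on_qubitZ i a A : on_qubit i (a *: A) = a *: on_qubit i A.
Proof. by apply/matrixP => s t; rewrite !on_qubitE !mxE mulrA. Qed.

Lemma on_qubit1 i : on_qubit i (1%:M : 'M[C]_2) = 1%:M.
Proof. by rewrite -tensor1; apply: eq_tensor => v; case: ifP. Qed.

Lemma on_qubitM i A B : on_qubit i A *m on_qubit i B = on_qubit i (A *m B).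
Proof.
by rewrite tensorM; apply: eq_tensor => v; case: ifP; rewrite ?mulmx1.
Qed.

Lemma on_qubit_adj i A : (on_qubit i A) ^t* = on_qubit i (A ^t*).
Proof.
rewrite tensor_adj; apply: eq_tensor => v; case: ifP => // _.
by rewrite trmx1 map_scalar_mx rmorph1.
Qed.

Lemma on_qubitsM i j A B : i != j ->
  on_qubit i A *m on_qubit j B = on_qubits2 i j A B.
Proof.
move=> ij; rewrite tensorM; apply: eq_tensor => v.
by case: eqP => [->|_]; rewrite ?(negbTE ij) ?mulmx1 ?mul1mx.
Qed.

Lemma on_qubitsMC i j A B : i != j ->
  on_qubit i A *m on_qubit j B = on_qubit j B *m on_qubit i A.
Proof.
move=> ij; rewrite !tensorM; apply: eq_tensor => v.
have [->|_] := eqVneq v i; last by case: ifP; rewrite ?mulmx1 ?mul1mx.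
by rewrite (negbTE ij) mulmx1 mul1mx.
Qed.

Lemma on_qubits_mul i j A B A' B' : i != j ->
  (on_qubit i A *m on_qubit j B) *m (on_qubit i A' *m on_qubit j B') =
  on_qubit i (A *m A') *m on_qubit j (B *m B').
Proof.
move=> ij; rewrite -!mulmxA (mulmxA (on_qubit j B)) -on_qubitsMC //.
by rewrite -!on_qubitM !mulmxA.
Qed.

Lemma on_qubits2_00 i j : i != j ->
  4%:R^-1 *: on_qubits2 i j (1%:M + pauliZ C) (1%:M + pauliZ C) =
  on_qubit i (ket0bra0 C) *m on_qubit j (ket0bra0 C).
Proof.
move=> ij; rewrite -on_qubitsM // add1_pauliZ !on_qubitZ.
rewrite -scalemxAl -scalemxAr !scalerA -[LHS]scale1r scalerA.
by rewrite -[RHS]scale1r; congr (_ *: _); field.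
Qed.

Lemma tr_on_qubit (rho : V -> 'M[C]_2) i A : (forall v, \tr (rho v) = 1) ->
  \tr (on_qubit i A *m tensor rho) = \tr (A *m rho i).
Proof.
move=> t1; rewrite tensorM tr_tensor (bigD1 i) //= eqxx big1 ?mulr1 //.
by move=> v /negbTE ->; rewrite mul1mx.
Qed.

Lemma tr_on_qubits (rho : V -> 'M[C]_2) i j A B : i != j ->
  (forall v, \tr (rho v) = 1) ->
  \tr (on_qubit i A *m on_qubit j B *m tensor rho) =
  \tr (A *m rho i) * \tr (B *m rho j).
Proof.
move=> ij t1; rewrite !tensorM tr_tensor (bigD1 i) //= (bigD1 j) /=; last by rewrite eq_sym.
rewrite !eqxx (negbTE ij) [j == i]eq_sym (negbTE ij) mulmx1 mul1mx big1 ?mulr1 //.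
by move=> v /andP[/negbTE -> /negbTE ->]; rewrite !mul1mx.
Qed.

End Tensor.

(** * The ground energy of one edge *)

Section Edge.
Variables (C : numClosedFieldType) (V : finType).
Local Notation r := (4194%:R / 1000%:R : C).

Lemma trZE (A : 'M[C]_2) : rank1_projector A ->
  \tr (pauliZ _ *m A) = 1 - 2%:R * A 1 1.
Proof.
move=> /proj11E a1; rewrite mxtrace2E !mulmx2E !mxE /=; ring: a1.
Qed.

(** With A' = 1 - A and B' = 1 - B, the two vertex terms together have eigenvalue 0 on A' B', 1 on A
    B' + A' B and 2 on A B. The weights of |00><00| on these spaces are products of <0|A|0> = 1 - x,
    <0|A'|0> = x and their analogues for B. The secular inequality is assumed here because [C] is an
    arbitrary closed field. *)
Lemma edge_energy_bound (i j : V) (A B : 'M[C]_2) (x := A 1 1) (y := B 1 1) :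
  i != j -> rank1_projector A -> rank1_projector B ->
  1 <= 2%:R * x -> 1 <= 2%:R * y ->
  (x + y) / (x * y * (r - 1)) *
    (((1 - x) * y + x * (1 - y)) / (1 - (x + y) / r) +
     (1 - x) * (1 - y) / (2%:R - (x + y) / r)) <= 1 ->
  forall v, (x + y) * dot v v <=
    r * dot (v *m (on_qubit i A + on_qubit j B + (x^-1 + y^-1) *:
       (on_qubit i (ket0bra0 C) *m on_qubit j (ket0bra0 C)))) v.
Proof.
move=> ij pA pB x0 y0 sec v.
have x1 : x <= 1 by rewrite -(proj_tr pA) lerDr proj_diag_ge0.
have y1 : y <= 1 by rewrite -(proj_tr pB) lerDr proj_diag_ge0.
have pos (z : C) : 1 <= 2%:R * z -> 0 < z.
  by move=> z0; rewrite -(pmulr_rgt0 z (ltr0n C 2)) (lt_le_trans ltr01).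
have xp := pos _ x0; have yp := pos _ y0.
have r0 : 0 < r by rewrite divr_gt0 ?ltr0n.
have r1 : 0 < r - 1.
  have -> : r - 1 = 3194%:R / 1000%:R by field.
  by rewrite divr_gt0 ?ltr0n.
pose P A' B' := on_qubit i A' *m on_qubit j B' : 'M[C]_#|basis V|.
have PM A1 B1 A2 B2 : P A1 B1 *m P A2 B2 = P (A1 *m A2) (B1 *m B2).
  exact: on_qubits_mul.
have Padj A1 B1 : (P A1 B1) ^t* = P (A1 ^t*) (B1 ^t*).
  by rewrite /P trmx_mul map_mxM /= !on_qubit_adj -on_qubitsMC.
have PDl A1 A2 B1 : P (A1 + A2) B1 = P A1 B1 + P A2 B1.
  by rewrite /P on_qubitD mulmxDl.
have PDr A1 B1 B2 : P A1 (B1 + B2) = P A1 B1 + P A1 B2.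
  by rewrite /P on_qubitD mulmxDr.
have PZ a b A1 B1 : P (a *: A1) (b *: B1) = (a * b) *: P A1 B1.
  by rewrite /P !on_qubitZ -scalemxAl -scalemxAr scalerA.
have P1l B1 : P 1%:M B1 = on_qubit j B1 by rewrite /P on_qubit1 mul1mx.
have P1r A1 : P A1 1%:M = on_qubit i A1 by rewrite /P on_qubit1 mulmx1.
have P11 : P 1%:M 1%:M = 1%:M by rewrite P1l on_qubit1.
have P0l B1 : P 0 B1 = 0 by have := PZ 0 1 0 B1; rewrite !scaler0 scale1r mul0r scale0r.
have P0r A1 : P A1 0 = 0 by have := PZ 1 0 A1 0; rewrite !scaler0 scale1r mulr0 scale0r.
pose A' := 1%:M - A; pose B' := 1%:M - B.
have sA : A + A' = 1%:M by rewrite addrC subrK.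
have sB : B + B' = 1%:M by rewrite addrC subrK.
have iA := proj_idem pA; have iB := proj_idem pB.
have iA' : A' *m A' = A' by exact: projC_idem.
have iB' : B' *m B' = B' by exact: projC_idem.
have hA := proj_adj pA; have hB := proj_adj pB.
have hA' : A' ^t* = A' by exact: projC_adj.
have hB' : B' ^t* = B' by exact: projC_adj.
have AA' : A *m A' = 0 by rewrite mulmxBr mulmx1 iA subrr.
have A'A : A' *m A = 0 by rewrite mulmxBl mul1mx iA subrr.
have BB' : B *m B' = 0 by rewrite mulmxBr mulmx1 iB subrr.
have B'B : B' *m B = 0 by rewrite mulmxBl mul1mx iB subrr.
pose k0 := ket0bra0 C.
have kA : k0 *m A *m k0 = (1 - x) *: k0.
  by rewrite ket0_compress /x (proj11E pA) opprB addrC subrK.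
have kB : k0 *m B *m k0 = (1 - y) *: k0.
  by rewrite ket0_compress /y (proj11E pB) opprB addrC subrK.
have kA' : k0 *m A' *m k0 = x *: k0.
  by rewrite ket0_compress !mxE /x (proj11E pA).
have kB' : k0 *m B' *m k0 = y *: k0.
  by rewrite ket0_compress !mxE /y (proj11E pB).
have [ik hk] := (ket0_idem C, ket0_adj C).
pose mu := (x + y) / r; pose L := x^-1 + y^-1.
(* The solution of [mu * (L + K) = x * y * L * K]. *)
pose K := (x + y) / (x * y * (r - 1)).
have s0 : 0 < x + y by rewrite addr_gt0.
have mu1 : mu < 1.
  rewrite ltr_pdivrMr // mul1r (le_lt_trans (lerD x1 y1)) //.
  by rewrite -subr_gt0 (_ : _ - _ = 2194%:R / 1000%:R) ?divr_gt0 ?ltr0n //; field.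
have := @rank1_perturbation_bound C _ (P A' B') (P A B' + P A' B) (P A B) (P k0 k0)
  (x * y) ((1 - x) * y + x * (1 - y)) ((1 - x) * (1 - y)) L K mu.
move=> /(_ _ _ _ _ _ _ _ _ _ _ _ _ _ v).
have -> : P A B' + P A' B + 2%:R *: P A B + L *: P k0 k0 =
   on_qubit i A + on_qubit j B + L *: P k0 k0.
  have -> : on_qubit i A = P A B + P A B' by rewrite -PDr sB P1r.
  have -> : on_qubit j B = P A B + P A' B by rewrite -PDl sA P1l.
  rewrite scaler_nat mulr2n; congr (_ + _).
  by rewrite addrC addrACA.
move=> bnd; have {}bnd : mu * dot v v <= _ := bnd _ _ _ _ _ _ _ _ _ _ _ _ _.
rewrite -ler_pdivrMl // mulrA [_^-1 * _]mulrC; apply: bnd.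
- by split; rewrite ?raddfD /= ?map_mxD /= !Padj ?hA ?hB ?hA' ?hB' ?hk.
- split; rewrite ?mulmxDl ?mulmxDr !PM ?iA ?iB ?iA' ?iB' ?ik //.
  by rewrite AA' A'A !P0l addr0 add0r.
- by rewrite mulmxDl !PM B'B A'A P0l P0r addr0.
- by rewrite mulmxDr !PM BB' AA' P0l P0r addr0.
- have : P (A + A') (B + B') = 1%:M by rewrite sA sB.
  move=> <-; rewrite (PDl A A') (PDr A B B') (PDr A' B B').
  by rewrite addrC [P A' B' + _]addrC -!addrA.
- by rewrite !PM (projC_compress_ket0 pA) (projC_compress_ket0 pB) PZ.
- by rewrite mulmxDr mulmxDl !PM kA kB' kA' kB !PZ -scalerDl.
- by rewrite !PM kA kB PZ.
- by rewrite addr_gt0 ?invr_gt0.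
- by rewrite divr_gt0 // !mulr_gt0.
- exact: mu1.
- rewrite /mu /L /K; field.
  by rewrite !gt_eqF ?ltr0n.
- exact: sec.
Qed.

End Edge.

(** * Bit lengths *)

Section Bits.
Variable C : numClosedFieldType.
Implicit Types (x y : C) (b D : nat).

(** The nonnegative real case of [bits_le]; without sign or imaginary part, inverses cost no
    bits. *)
Definition ratio_le b x := exists p d : nat,
  [/\ (p < 2 ^ b)%N, (0 < d < 2 ^ b)%N & x = p%:R / d%:R].

(** Having [D] as a denominator is stable under sums and nonnegative differences, so repeated
    updates do not enlarge it. *)
Definition multiple D x := exists k : nat, x * D%:R = k%:R.

Lemma bits_le_mono b b' x : (b <= b')%N -> bits_le b x -> bits_le b' x.
Proof.
move=> bb [p [q [d [pb qb /andP[d0 db] ->]]]].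
have le2 : (2 ^ b <= 2 ^ b')%N by rewrite leq_exp2l.
by exists p, q, d; split=> //; rewrite ?d0 ?(leq_trans _ le2).
Qed.

Lemma ratio_bits b x : ratio_le b x -> bits_le b x.
Proof.
move=> [p [d [pb db ->]]]; exists p%:Z, 0, d; split=> //.
  by rewrite absz0 expn_gt0.
by rewrite mulr0 addr0.
Qed.

Lemma bits_nat b n : (0 < b)%N -> (n <= 1)%N -> bits_le b (n%:R : C).
Proof.
move=> b0 n1; apply: ratio_bits; exists n, 1%N.
have b2 : (1 < 2 ^ b)%N by rewrite -[1%N](expn0 2) ltn_exp2l.
by split; rewrite ?divr1 // (leq_ltn_trans n1).
Qed.

Lemma pow_double b : (2 ^ (2 * b + 1) = 2 * (2 ^ b * 2 ^ b))%N.
Proof. by rewrite addn1 expnS -expnD addnn -mul2n. Qed.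

Lemma bitsB b x y : bits_le b x -> bits_le b y -> bits_le (2 * b + 1) (x - y).
Proof.
move=> [p [q [d [pb qb /andP[d0 db] ->]]]] [p' [q' [d' [pb' qb' /andP[d0' db'] ->]]]].
have num (u u' : int) : (`|u| < 2 ^ b)%N -> (`|u'| < 2 ^ b)%N ->
    (`|(u * d'%:Z - u' * d%:Z)%R| < 2 ^ (2 * b + 1))%N.
  move=> ub ub'; rewrite pow_double.
  have h1 := ltn_mul ub db'; have h2 := ltn_mul ub' db.
  have e1 : `|(u * d'%:Z)%R|%N = (`|u| * d')%N by rewrite abszM.
  have e2 : `|(u' * d%:Z)%R|%N = (`|u'| * d)%N by rewrite abszM.
  rewrite -e1 -e2 in h1 h2; move: (2 ^ b * 2 ^ b)%N (u * _)%R (u' * _)%R h1 h2.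
  by move=> z w w' {e1 e2 ub ub' pb pb' qb qb' db db' d0 d0'}; lia.
exists (p * d'%:Z - p' * d%:Z), (q * d'%:Z - q' * d%:Z), (d * d')%N; split.
- exact: num.
- exact: num.
- have := ltn_mul db db'; rewrite pow_double muln_gt0 d0 d0'.
  by move: (2 ^ b * 2 ^ b)%N (d * d')%N => z t /=; lia.
rewrite natrM !rmorphB !rmorphM /= -!pmulrn; field.
by rewrite !pnatr_eq0 -!lt0n d0 d0'.
Qed.

(** A nonnegative number equals its conjugate, which kills the imaginary numerator; the real
    numerator is then nonnegative. *)
Lemma bits_ratio b x : 0 <= x -> bits_le b x -> ratio_le b x.
Proof.
move=> x0 [p [q [d [pb qb /andP[d0 db] xE]]]]; exists `|p|%N, d.
split; rewrite ?d0 //.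
have dn0 : (0 : C) < d%:R by rewrite ltr0n.
have xd : x * d%:R = p%:~R + 'i * q%:~R by rewrite xE divfK ?gt_eqF.
have xd0 : 0 <= x * d%:R by rewrite mulr_ge0 ?ler0n.
have : x * d%:R \is Num.real by rewrite ger0_real.
rewrite xd CrealE rmorphD rmorphM /= conjCi !rmorph_int => /eqP/addrI/eqP.
rewrite mulNr eq_sym -subr_eq0 opprK -mulr2n mulrn_eq0 /= mulf_eq0.
rewrite (negbTE (neq0Ci C)) intr_eq0 /= => /eqP q0.
move: xd; rewrite q0 mulr0 addr0 => xd; move: xd0; rewrite xd ler0z => p0.
by rewrite pmulrn gez0_abs // -xd mulfK // gt_eqF.
Qed.

Lemma ratioD b x y : ratio_le b x -> ratio_le b y -> ratio_le (2 * b + 1) (x + y).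
Proof.
move=> [p [d [pb /andP[d0 db] ->]]] [p' [d' [pb' /andP[d0' db'] ->]]].
exists (p * d' + p' * d)%N, (d * d')%N; rewrite pow_double; split.
- have := ltn_mul pb db'; have := ltn_mul pb' db.
  by move: (2 ^ b * 2 ^ b)%N (p * d')%N (p' * d)%N => z t u; lia.
- have := ltn_mul db db'; rewrite muln_gt0 d0 d0'.
  by move: (2 ^ b * 2 ^ b)%N (d * d')%N => z t /=; lia.
rewrite natrD !natrM; field.
by rewrite !pnatr_eq0 -!lt0n d0 d0'.
Qed.

Lemma ratioM b b' x y : ratio_le b x -> ratio_le b' y -> ratio_le (b + b') (x * y).
Proof.
move=> [p [d [pb /andP[d0 db] ->]]] [p' [d' [pb' /andP[d0' db'] ->]]].
exists (p * p')%N, (d * d')%N; split.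
- by rewrite expnD ltn_mul.
- by rewrite muln_gt0 d0 d0' expnD ltn_mul.
by rewrite !natrM mulf_div.
Qed.

Lemma ratioV b x : 0 < x -> ratio_le b x -> ratio_le b x^-1.
Proof.
move=> + [p [d [pb /andP[d0 db] xE]]]; rewrite xE pmulr_lgt0 ?invr_gt0 ?ltr0n // => p0.
by exists d, p; rewrite p0 pb db invf_div.
Qed.

Lemma ratio_lt b x : ratio_le b x -> x < (2 ^ b)%:R.
Proof.
move=> [p [d [pb /andP[d0 db] ->]]]; rewrite ltr_pdivrMr ?ltr0n // -natrM ltr_nat.
by rewrite (leq_trans pb) // leq_pmulr.
Qed.

Lemma ratio_mono b b' x : (b <= b')%N -> ratio_le b x -> ratio_le b' x.
Proof.
move=> bb [p [d [pb /andP[d0 db] ->]]].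
have le2 : (2 ^ b <= 2 ^ b')%N by rewrite leq_exp2l.
by exists p, d; split; rewrite ?d0 ?(leq_trans _ le2).
Qed.

Lemma common_denominator B (s : seq C) : (forall x, x \in s -> ratio_le B x) ->
  exists D, (0 < D <= 2 ^ (B * size s))%N /\ forall x, x \in s -> multiple D x.
Proof.
elim: s => [|x s IHs] sB; first by exists 1%N; rewrite expn_gt0.
have [|D [/andP[D0 DB] sD]] := IHs; first by move=> y ys; apply: sB; rewrite inE ys orbT.
have [p [d [pB /andP[d0 dB] xE]]] := sB x (mem_head _ _).
exists (d * D)%N; split.
  by rewrite muln_gt0 d0 D0 /= mulnS expnD leq_mul // ltnW.
move=> y; rewrite inE => /predU1P[->|/sD[k kE]].
  exists (p * D)%N; rewrite xE !natrM mulrA divfK // pnatr_eq0 -lt0n //.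
by exists (d * k)%N; rewrite !natrM mulrCA kE.
Qed.

Lemma multipleM D D' x y : multiple D x -> multiple D' y -> multiple (D * D') (x * y).
Proof. by move=> [k xE] [l yE]; exists (k * l)%N; rewrite !natrM mulrACA xE yE. Qed.

Lemma multipleD D x y : multiple D x -> multiple D y -> multiple D (x + y).
Proof. by move=> [k xE] [l yE]; exists (k + l)%N; rewrite mulrDl xE yE natrD. Qed.

Lemma multipleB D x y : y <= x -> multiple D x -> multiple D y -> multiple D (x - y).
Proof.
move=> yx [k xE] [l yE]; exists (k - l)%N; rewrite mulrBl xE yE natrB //.
by rewrite -(ler_nat C) -xE -yE ler_wpM2r ?ler0n.
Qed.

Lemma multiple_mull D D' x : multiple D x -> multiple (D' * D) x.
Proof. by move=> [k xE]; exists (D' * k)%N; rewrite !natrM mulrCA xE. Qed.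

(** A bound on the value bounds the numerator by 2^b D. The extra bit is for the denominator, which
    may equal 2^d while [bits_le] is strict. *)
Lemma multiple_bits D b d x : (0 < D <= 2 ^ d)%N -> multiple D x -> 0 <= x ->
  x < (2 ^ b)%:R -> bits_le (b + d + 1) x.
Proof.
move=> /andP[D0 Dd] [k xE] x0 xb; apply: ratio_bits; exists k, D.
have Dp : (0 : C) < D%:R by rewrite ltr0n.
have kD : (k < 2 ^ b * D)%N by rewrite -(ltr_nat C) -xE natrM ltr_pM2r.
have bD : (2 ^ b * D <= 2 ^ b * 2 ^ d)%N by rewrite leq_mul2l Dd orbT.
have Dd' : (2 ^ d <= 2 ^ b * 2 ^ d)%N by rewrite leq_pmull // expn_gt0.
have d0 : (0 < 2 ^ d)%N by rewrite expn_gt0.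
move: (2 ^ b * 2 ^ d)%N (2 ^ b * D)%N (expnD 2 b d) bD Dd' kD => z t zE *.
rewrite !(expnD _ _ 1) zE; split; [lia|lia|].
by rewrite -xE mulfK // gt_eqF.
Qed.

End Bits.

(** * The steps of the algorithm *)

Section Programs.
Variable C : numClosedFieldType.

Lemma size_bind (A B : Type) (m : prog C A) (f : A -> prog C B) :
  size (bind m f).2 = (size m.2 + size (f m.1).2)%N.
Proof. exact: size_cat. Qed.

Lemma size_p_for (T S : Type) (r : seq T) (body : T -> S -> prog C S) s K :
  (forall t s, size (body t s).2 <= K)%N ->
  (size (p_for r body s).2 <= size r * K.+1)%N.
Proof.
move=> bK; elim: r s => //= t r IHr s.
by rewrite size_cat mulSn -addSn leq_add // ltnS.
Qed.

(** Nonnegativity makes x and y real, hence comparable; otherwise a failed test x <= y would not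
    give y <= x. *)
Lemma min_lower (x y : C) : 0 <= x -> 0 <= y ->
  let m := (p_min x y).1 in [/\ m <= x, m <= y & m = x \/ m = y].
Proof.
move=> x0 y0 /=; case: ifP => [xy|/negbT]; first by split=> //; left.
by rewrite -real_ltNge ?ger0_real // => /ltW yx; split=> //; right.
Qed.

Lemma min_gt0 (x y : C) : 0 <= x -> 0 <= y ->
  (0 < (p_min x y).1) = (0 < x) && (0 < y).
Proof.
move=> x0 y0; have [mx my mE] := min_lower x0 y0.
apply/idP/andP => [m0|[]]; first by rewrite !(lt_le_trans m0).
by case: mE => ->.
Qed.

End Programs.

Section Instance.
Variables (R : realType) (V : finType) (I : instance R V).
Local Notation C := (R[i] : numClosedFieldType).
Implicit Types (s : state R V) (i j : V) (e : V * V) (rho : V -> 'M[C]_2).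

(* The x_i of the header. *)
Definition excited i : C := phi I i 1 1.
(** Since Tr(Z phi_i) = 1 - 2 x_i, the term 2 / (1 - Tr(Z phi_i)) of the algorithm is 1 / x_i. *)
Definition lambda i j : C := (excited i)^-1 + (excited j)^-1.

Lemma excited_ge_half i : 1 <= 2%:R * excited i.
Proof. by have := phi_trZ I i; rewrite (trZE (phi_proj I i)) subr_le0. Qed.

Lemma excited_le1 i : excited i <= 1.
Proof. by rewrite -(proj_tr (phi_proj I i)) lerDr (proj_diag_ge0 (phi_proj I i)). Qed.

Lemma excited_gt0 i : 0 < excited i.
Proof.
by rewrite -(pmulr_rgt0 _ (ltr0n C 2)) (lt_le_trans ltr01) ?excited_ge_half.
Qed.

Lemma lambda_gt0 i j : 0 < lambda i j.
Proof. by rewrite addr_gt0 ?invr_gt0 ?excited_gt0. Qed.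

Lemma inv_double (F : numFieldType) (z : F) : 2%:R / (1 - (1 - 2%:R * z)) = z^-1.
Proof.
have -> : 1 - (1 - 2%:R * z) = 2%:R * z by rewrite opprB addrC subrK.
by rewrite invfM mulrA divff ?mul1r // pnatr_eq0.
Qed.

Lemma lambda_prog_val i j : (lambda_prog I i j).1 = lambda i j.
Proof. by rewrite lambda_progE !(trZE (phi_proj I _)) !inv_double. Qed.

Lemma edgesP e : e \in edges I -> adj I e.1 e.2 /\ e.1 != e.2.
Proof.
rewrite mem_filter => /andP[/andP[ae _] _]; split=> //.
by apply: contraTneq ae => ->; rewrite adj_irr.
Qed.

Lemma edges_uniq : uniq (edges I).
Proof. by rewrite filter_uniq // enum_uniq. Qed.

Definition nonneg s := (forall i, 0 <= curV s i) /\
  (forall e, e \in edges I -> 0 <= curE s e).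

Definition active s e := [&& 0 < curV s e.1, 0 < curV s e.2 & 0 < curE s e].

Lemma nonneg_init : nonneg (init I).
Proof.
split=> [i|e /edgesP[ae _]]; rewrite ffunE; first exact: cV_ge0.
exact: cE_ge0.
Qed.

Lemma step1_val s : (step1 s).1 = State (curV s) (curE s)
  [ffun i => if curV s i == 0 then Some (ket1bra1 C) else out s i].
Proof.
suff gen (r : seq V) t : (p_for r (fun i s =>
    let* c := p_read (curV s) i in
    let* b := p_is0 c in
    if b then
      let* r := p_write_mx (out s) i (ket1bra1 C) in
      ret (State (curV s) (curE s) r)
    else ret s) t).1 = State (curV t) (curE t)
    [ffun i => if (i \in r) && (curV t i == 0) then Some (ket1bra1 C) else out t i].
  rewrite /step1 gen; congr State; apply/ffunP => i.
  by rewrite !ffunE mem_enum.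
elim: r t => [|j r IHr] t /=.
  by case: t => cv ce o; congr State; apply/ffunP => i; rewrite ffunE.
rewrite {}IHr; case: ifP => /= cj; congr State; apply/ffunP => i;
  rewrite !ffunE inE.
  by have [->|_] := eqVneq i j; rewrite ?cj ?if_same.
by have [->|_] := eqVneq i j; rewrite ?cj ?andbF.
Qed.

Lemma step5_val s : (step5 I s).1 = State (curV s) (curE s)
  [ffun i => if 0 < curV s i then Some (1%:M - phi I i) else out s i].
Proof.
suff gen (r : seq V) t : (p_for r (fun i s =>
    let* c := p_read (curV s) i in
    let* b := p_lt 0 c in
    if b then
      let* A := p_mx (phi I i) in
      let* r := p_write_mx (out s) i (1%:M - A) in
      ret (State (curV s) (curE s) r)
    else ret s) t).1 = State (curV t) (curE t)
    [ffun i => if (i \in r) && (0 < curV t i) then Some (1%:M - phi I i) else out t i].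
  rewrite /step5 gen; congr State; apply/ffunP => i.
  by rewrite !ffunE mem_enum.
elim: r t => [|j r IHr] t /=.
  by case: t => cv ce o; congr State; apply/ffunP => i; rewrite ffunE.
rewrite {}IHr; case: ifP => /= cj; congr State; apply/ffunP => i;
  rewrite !ffunE inE.
  by have [->|_] := eqVneq i j; rewrite ?cj ?if_same.
by have [->|_] := eqVneq i j; rewrite ?cj ?andbF.
Qed.

Lemma eligibleP s e : nonneg s ->
  (e \in (eligible I s).1) = (e \in edges I) && active s e.
Proof.
move=> [v0 e0]; rewrite /eligible.
set body := fun _ _ => _.
suff gen (r : seq (V * V)) l : {subset r <= edges I} ->
    (e \in (p_for r body l).1) = (e \in l) || (e \in r) && active s e.
  by rewrite gen.
elim: r l => [|f r IHr] l sub /=; first by rewrite orbF.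
rewrite IHr => [|g gr]; last by rewrite sub // inE gr orbT.
have -> : 0 < (if (if curV s f.1 <= curV s f.2 then curV s f.1 else curV s f.2)
   <= curE s f then if curV s f.1 <= curV s f.2 then curV s f.1 else curV s f.2
   else curE s f) = active s f.
  have fE : f \in edges I by rewrite sub // mem_head.
  have := min_gt0 (v0 f.1) (v0 f.2).
  have [_ _ mE] := min_lower (v0 f.1) (v0 f.2).
  have m0 : 0 <= (p_min (curV s f.1) (curV s f.2)).1 by case: mE => ->.
  by have := min_gt0 m0 (e0 f fE) => /= -> ->; rewrite -andbA.
rewrite inE; case: ifP => af; rewrite ?inE.
  by have [->|_] := eqVneq e f; rewrite ?af ?orbT.
by have [->|_] := eqVneq e f; rewrite ?af ?andbF.
Qed.

(** The inequalities keep the coefficients nonnegative; the attained equality is what makes a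
    coefficient vanish. *)
Definition is_weight s e (w : C) :=
  [/\ 0 < w, w <= curV s e.1, w <= curV s e.2 & w * lambda e.1 e.2 <= curE s e]
  /\ [\/ w = curV s e.1, w = curV s e.2 | w = curE s e / lambda e.1 e.2].

Definition weight s e : C :=
  (p_min (p_min (curV s e.1) (curV s e.2)).1 (curE s e / lambda e.1 e.2)).1.

Lemma weightP s e : nonneg s -> e \in edges I -> active s e ->
  is_weight s e (weight s e).
Proof.
move=> [v0 e0] eE /and3P[i0 j0 ij0].
have l0 := lambda_gt0 e.1 e.2.
have q0 : 0 < curE s e / lambda e.1 e.2 by rewrite divr_gt0.
have [mi mj mE] := min_lower (v0 e.1) (v0 e.2).
have m0 : 0 < (p_min (curV s e.1) (curV s e.2)).1 by rewrite min_gt0 ?i0.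
have [wm wq wE] := min_lower (ltW m0) (ltW q0).
split.
  split; rewrite ?(le_trans wm) //; last by rewrite -ler_pdivlMr.
  by rewrite /weight min_gt0 ?ltW // m0.
rewrite -/(weight s e) in wE.
by case: wE => ->; [case: mE => ->|]; [constructor 1|constructor 2|constructor 3].
Qed.

(** The indicator form turns the two array writes into one subtraction, from which [ham_step]
    extracts the local Hamiltonian by linearity. *)
Lemma step3_val s e : e.1 != e.2 -> let w := weight s e in
  (step3 I e s).1 = State
    [ffun i => curV s i - w * ((i == e.1)%:R + (i == e.2)%:R)]
    [ffun f => curE s f - w * lambda e.1 e.2 * (f == e)%:R] (out s).
Proof.
move=> ne w; have lE := lambda_prog_val e.1 e.2; rewrite /= in lE.
rewrite /step3 [LHS]/= lE.
have wE : w = weight s e by []; rewrite /weight /= in wE; rewrite -wE.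
clearbody w; congr State; apply/ffunP => i; rewrite !ffunE.
  have [->|_] := eqVneq i e.2.
    by rewrite eq_sym (negbTE ne) add0r mulr1.
  by have [->|_] := eqVneq i e.1; rewrite ?addr0 ?mulr1 ?mulr0 ?subr0.
by case: eqVneq => [->|_]; rewrite ?mulr1 ?mulr0 ?subr0.
Qed.

End Instance.

(** * Energies *)

Lemma ratio_comb (F : numDomainType) (w a a' q d d' c : F) : 0 <= w ->
  a * q <= c * d -> a' * q <= c * d' -> (w * a + a') * q <= c * (w * d + d').
Proof.
move=> w0 ad ad'; rewrite mulrDl mulrDr lerD // -mulrA [leRHS]mulrCA.
by rewrite ler_wpM2l.
Qed.

Section Energy.
Variables (R : realType) (V : finType) (I : instance R V).
Local Notation C := (R[i] : numClosedFieldType).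
Local Notation r := (4194%:R / 1000%:R : C).
Implicit Types (s : state R V) (i j : V) (e : V * V) (rho : V -> 'M[C]_2).

Definition vertex_term i := on_qubit i (phi I i).
Definition edge_term e : 'M[C]_#|basis V| :=
  on_qubit e.1 (ket0bra0 C) *m on_qubit e.2 (ket0bra0 C).

Definition ham s : 'M[C]_#|basis V| :=
  \sum_i curV s i *: vertex_term i + \sum_(e <- edges I) curE s e *: edge_term e.

Definition local_ham e :=
  vertex_term e.1 + vertex_term e.2 + lambda I e.1 e.2 *: edge_term e.

Definition energy rho (A : 'M[C]_#|basis V|) := \tr (A *m tensor rho).

Lemma ham_init : hamiltonian I = ham (init I).
Proof.
congr (_ + _); first by apply: eq_bigr => i _; rewrite ffunE.
rewrite !big_seq; apply: eq_bigr => e /edgesP[_ ne].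
by rewrite ffunE on_qubits2_00.
Qed.

Lemma sum_delta (J : eqType) (M : lmodType C) (l : seq J) (F : J -> M) k :
  uniq l -> k \in l -> \sum_(j <- l) (j == k)%:R *: F j = F k.
Proof.
move=> ul kl; rewrite (bigD1_seq k) //= eqxx scale1r big1 ?addr0 // => j.
by move=> /negbTE ->; rewrite scale0r.
Qed.

Lemma ham_step s e : e \in edges I ->
  ham s = weight I s e *: local_ham e + ham (step3 I e s).1.
Proof.
move=> eE; have [_ ne] := edgesP eE; rewrite step3_val // /ham /=.
move: (weight I s e) => w.
under [in RHS]eq_bigr do rewrite ffunE mulrDr scalerBl scalerDl -!scalerA.
under [X in _ = _ + (_ + X)]eq_bigr do rewrite ffunE scalerBl -!scalerA.
rewrite !sumrB big_split /= -!scaler_sumr.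
have ue := index_enum_uniq V; have me i := mem_index_enum i.
rewrite !(sum_delta vertex_term ue) // (sum_delta edge_term (edges_uniq I)) //.
rewrite /local_ham !scalerDr.
by rewrite addrACA [_ + (_ - _)]addrC subrK [_ + (_ - _)]addrC subrK.
Qed.

Lemma energyD rho A B : energy rho (A + B) = energy rho A + energy rho B.
Proof. by rewrite /energy mulmxDl raddfD. Qed.

Lemma energyZ rho a A : energy rho (a *: A) = a * energy rho A.
Proof. by rewrite /energy -scalemxAl linearZ. Qed.

Lemma energy_sum rho (J : Type) (l : seq J) (F : J -> 'M[C]_#|basis V|) :
  energy rho (\sum_(j <- l) F j) = \sum_(j <- l) energy rho (F j).
Proof. by rewrite /energy mulmx_suml raddf_sum. Qed.

(** The output is known only after the last round, so the bound of each round is proved for all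
    these states at once. *)
Definition admissible rho :=
  forall i, rho i = ket1bra1 C \/ rho i = 1%:M - phi I i.

Lemma admissible_tr rho : admissible rho -> forall i, \tr (rho i) = 1.
Proof.
move=> ad i; case: (ad i) => ->; first exact: tr_ket1.
exact: tr_projC (phi_proj I i).
Qed.

Lemma vertex_energy rho i : admissible rho ->
  energy rho (vertex_term i) = \tr (phi I i *m rho i).
Proof. by move=> ad; apply/tr_on_qubit/admissible_tr. Qed.

Lemma edge_energy rho e : admissible rho -> e \in edges I ->
  energy rho (edge_term e) =
  \tr (ket0bra0 C *m rho e.1) * \tr (ket0bra0 C *m rho e.2).
Proof.
by move=> ad /edgesP[_ ne]; apply: tr_on_qubits => //; apply: admissible_tr.
Qed.

(** This explains the choice of [lambda]: two excited qubits cost x + y, two complements cost lambda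
    x y, which is also x + y, and a mixed pair costs only x or y. *)
Lemma local_energy_le rho e : admissible rho -> e \in edges I ->
  energy rho (local_ham e) <= excited I e.1 + excited I e.2.
Proof.
move=> ad eE; rewrite !energyD energyZ !vertex_energy // edge_energy //.
have x0 := excited_gt0 I e.1; have y0 := excited_gt0 I e.2.
rewrite /lambda; case: (ad e.1) => ->; case: (ad e.2) => ->;
  rewrite ?tr_ket0_ket1 ?tr_proj_ket1 ?(tr_proj_projC (phi_proj I _))
    ?(tr_ket0_projC (phi_proj I _)) -?/(excited I e.1)
    -?/(excited I e.2) ?(mul0r, mulr0, addr0, add0r) //.
- by rewrite lerDl ltW.
- by rewrite lerDr ltW.
- rewrite mulrDl mulrA mulVf ?gt_eqF // mul1r mulrCA mulVf ?gt_eqF // mulr1.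
  by rewrite addrC.
Qed.

Lemma vertex_term_ge0 i v : 0 <= dot (v *m vertex_term i) v.
Proof.
apply: proj_form_ge0; rewrite /vertex_term.
  by rewrite on_qubit_adj (proj_adj (phi_proj I i)).
by rewrite on_qubitM (proj_idem (phi_proj I i)).
Qed.

Lemma edge_term_ge0 e v : e \in edges I -> 0 <= dot (v *m edge_term e) v.
Proof.
move=> /edgesP[_ ne]; apply: proj_form_ge0; rewrite /edge_term.
  by rewrite trmx_mul map_mxM /= !on_qubit_adj -on_qubitsMC // ket0_adj.
by rewrite on_qubits_mul // ket0_idem.
Qed.

Lemma ham_form s v : dot (v *m ham s) v =
  \sum_i curV s i * dot (v *m vertex_term i) v +
  \sum_(e <- edges I) curE s e * dot (v *m edge_term e) v.
Proof.
rewrite mulmxDr dotDl !mulmx_sumr /dot !mulmx_suml !summxE.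
by congr (_ + _); apply: eq_bigr => j _; rewrite -scalemxAr -scalemxAl mxE.
Qed.

Lemma ham_ge0 s v : nonneg I s -> 0 <= dot (v *m ham s) v.
Proof.
move=> [v0 e0]; rewrite ham_form addr_ge0 //.
  by apply: sumr_ge0 => i _; apply: mulr_ge0; [exact: v0|exact: vertex_term_ge0].
rewrite big_seq; apply: sumr_ge0 => e eE.
by apply: mulr_ge0; [exact: e0|exact: edge_term_ge0].
Qed.

Lemma ham_adj s : nonneg I s -> (ham s) ^t* = ham s.
Proof.
move=> [v0 e0]; rewrite /ham linearD /= map_mxD !adj_sum; congr (_ + _).
  by apply: eq_bigr => i _; rewrite adj_scale // on_qubit_adj (proj_adj (phi_proj I i)).
rewrite !big_seq; apply: eq_bigr => e eE; have [_ ne] := edgesP eE.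
rewrite adj_scale ?e0 //.
by rewrite trmx_mul map_mxM /= !on_qubit_adj -on_qubitsMC // ket0_adj.
Qed.

(** The output in terms of the final coefficients alone: the last pass of step 1 writes every zero
    vertex, and step 5 overwrites all others. *)
Definition rounded s i : 'M[C]_2 :=
  if curV s i == 0 then ket1bra1 C else 1%:M - phi I i.

Lemma rounded_admissible s : admissible (rounded s).
Proof. by move=> i; rewrite /rounded; case: ifP; [left|right]. Qed.

(** A vertex term vanishes by its coefficient or because phi_i (1 - phi_i) = 0. An inactive edge has
    a zero coefficient or an endpoint in |1>, which |0><0| annihilates. *)
Lemma energy_final s : nonneg I s ->
  (forall e, e \in edges I -> ~~ active s e) -> energy (rounded s) (ham s) = 0.
Proof.
move=> [v0 e0] na; have ad := rounded_admissible s.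
rewrite energyD !energy_sum big1 ?add0r => [|i _].
  rewrite big_seq big1 // => e eE; rewrite energyZ edge_energy //.
  have := na e eE; rewrite /active !lt_neqAle !v0 e0 // !andbT !(eq_sym 0).
  rewrite /rounded; do 2 case: eqP => _ /=;
    rewrite ?tr_ket0_ket1 ?mul0r ?mulr0 //.
  by rewrite negbK => /eqP ->; rewrite mul0r.
rewrite energyZ vertex_energy // /rounded; case: eqP => [->|_]; rewrite ?mul0r //.
by rewrite (tr_proj_projC (phi_proj I _)) mulr0.
Qed.

Lemma nonneg_step s e : nonneg I s -> e \in edges I -> active s e ->
  nonneg I (step3 I e s).1.
Proof.
move=> nn eE ae; have [[w0 wi wj wl] _] := weightP nn eE ae.
have [_ ne] := edgesP eE; case: nn => v0 e0; rewrite step3_val //; split=> /= [i|f fE].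
  rewrite ffunE subr_ge0; have [->|_] := eqVneq i e.1.
    by rewrite (negbTE ne) addr0 mulr1.
  by have [->|_] := eqVneq i e.2; rewrite ?add0r ?mulr1 ?mulr0.
rewrite ffunE subr_ge0; have [->|_] := eqVneq f e; first by rewrite mulr1.
by rewrite mulr0 e0.
Qed.

(** * Number of rounds and running time *)

Definition measure s :=
  (count (fun i => curV s i != 0%R) (enum V) +
   count (fun e => curE s e != 0%R) (edges I))%N.

Lemma sub_in_count (T : eqType) (a b : pred T) (l : seq T) :
  (forall t, t \in l -> a t -> b t) -> (count a l <= count b l)%N.
Proof.
elim: l => //= t l IHl ab; apply: leq_add.
  by case at_: (a t) => //; rewrite (ab t) ?mem_head.
by apply: IHl => u ul; apply: ab; rewrite inE ul orbT.
Qed.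

Lemma count_lt (T : eqType) (a b : pred T) (l : seq T) k :
  (forall t, t \in l -> a t -> b t) -> k \in l -> b k -> ~~ a k ->
  (count a l < count b l)%N.
Proof.
move=> + kl bk ak; rewrite (permP (perm_to_rem kl)) (permP (perm_to_rem kl)) /=.
rewrite bk (negbTE ak) add0n add1n ltnS => ab; apply: sub_in_count => t tl.
by apply: ab; apply: mem_rem tl.
Qed.

(** Coefficients only decrease and stay nonnegative, so zeros persist; the term attaining the
    minimum yields a new one. *)
Lemma measure_step s e : nonneg I s -> e \in edges I -> active s e ->
  (measure (step3 I e s).1 < measure s)%N.
Proof.
move=> nn eE ae; have [[w0 wi wj wl] wE] := weightP nn eE ae.
have [_ ne] := edgesP eE; have nn' := nonneg_step nn eE ae.
have [v0 e0] := nn; have /and3P[i0 j0 ij0] := ae.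
move: nn'; rewrite /measure step3_val //; set s' := State _ _ _ => -[v0' e0'].
have l0 := lambda_gt0 I e.1 e.2.
have sv i : curV s' i <= curV s i.
  by rewrite ffunE gerBl mulr_ge0 ?addr_ge0 // ltW.
have se f : curE s' f <= curE s f.
  by rewrite ffunE gerBl !mulr_ge0 // ltW.
have kv i : curV s' i != 0 -> curV s i != 0.
  apply: contraNneq => ci; move: (sv i) (v0' i); rewrite ci => c1 c2.
  by rewrite eq_le c1 c2.
have ke f : f \in edges I -> curE s' f != 0 -> curE s f != 0.
  move=> fE; apply: contraNneq => ci; move: (se f) (e0' f fE); rewrite ci => c1 c2.
  by rewrite eq_le c1 c2.
have lev : (count (fun i => curV s' i != 0%R) (enum V) <=
            count (fun i => curV s i != 0%R) (enum V))%N by exact: sub_count.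
have lee : (count (fun f => curE s' f != 0%R) (edges I) <=
            count (fun f => curE s f != 0%R) (edges I))%N.
  by apply: sub_in_count.
have ltv k : 0 < curV s k -> curV s' k = 0 ->
    (count (fun i => curV s' i != 0%R) (enum V) <
     count (fun i => curV s i != 0%R) (enum V))%N.
  move=> k0 k0'; apply: (@count_lt _ _ _ _ k) => [i _||/=|/=].
  - exact: kv.
  - by rewrite mem_enum.
  - by rewrite gt_eqF.
  - by rewrite k0' eqxx.
case: wE => wE.
- rewrite -addSn leq_add //; apply: ltv i0 _.
  by rewrite ffunE eqxx (negbTE ne) addr0 mulr1 wE subrr.
- rewrite -addSn leq_add //; apply: ltv j0 _.
  by rewrite ffunE eqxx [_ == e.1]eq_sym (negbTE ne) add0r mulr1 wE subrr.
- rewrite -addnS leq_add //; apply: (@count_lt _ _ _ _ e) => [f fE|//|/=|/=].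
  + exact: ke.
  + by rewrite gt_eqF.
  + by rewrite ffunE eqxx mulr1 wE divfK ?subrr ?eqxx // gt_eqF.
Qed.

Lemma size_step1 s : (size (step1 s).2 <= 7 * #|V|)%N.
Proof.
rewrite mulnC cardE; apply: size_p_for => i t.
by rewrite !size_bind /=; case: ifP.
Qed.

Lemma size_eligible s : (size (eligible I s).2 <= 7 * size (edges I))%N.
Proof. by rewrite mulnC; apply: size_p_for => i t; rewrite !size_bind. Qed.

Lemma size_step3 s e : size (step3 I e s).2 = 24%N.
Proof. by []. Qed.

Lemma size_step5 s : (size (step5 I s).2 <= 11 * #|V|)%N.
Proof.
rewrite mulnC cardE; apply: size_p_for => i t.
by rewrite !size_bind /=; case: ifP.
Qed.

Let n := (#|V| + size (edges I))%N.

Lemma loopS sel f k s s1 l lg1 lg2 :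
  step1 s = (s1, lg1) -> eligible I s1 = (l, lg2) ->
  loop I sel f.+1 k s =
  if l is e :: _ then
    let p := step3 I (nth e l (sel k %% size l)%N) s1 in
    let q := loop I sel f k.+1 p.1 in (q.1, lg1 ++ lg2 ++ 0 :: p.2 ++ q.2)
  else (Some (out (step5 I s1).1), lg1 ++ lg2 ++ (step5 I s1).2 ++ [::]).
Proof. by move=> st el; rewrite [LHS]/= st /bind /= el; case: l {el}. Qed.

(** Step 1 changes only [out], on which neither [nonneg], [ham] nor [measure] depends; the analysis
    can thus follow the state before step 1. *)
Definition same_weights s s1 := curV s1 = curV s /\ curE s1 = curE s.

Lemma step1_same s : same_weights s (step1 s).1.
Proof. by rewrite step1_val. Qed.

Lemma step3_same s s1 e : same_weights s s1 ->
  same_weights (step3 I e s).1 (step3 I e s1).1.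
Proof. by case: s s1 => [v w o] [v1 w1 o1] [/= -> ->]. Qed.

Lemma step5_out s s1 lg : nonneg I s -> step1 s = (s1, lg) ->
  out (step5 I s1).1 = [ffun i => Some (rounded s i)].
Proof.
move=> [v0 _] st; have -> : s1 = (step1 s).1 by rewrite st.
rewrite step5_val step1_val /=; apply/ffunP => i; rewrite !ffunE.
by rewrite /rounded lt_neqAle v0 andbT eq_sym; case: eqP.
Qed.

Lemma local_bound rho e v : admissible rho -> e \in edges I ->
  energy rho (local_ham e) * dot v v <= r * dot (v *m local_ham e) v.
Proof.
move=> ad eE; have [_ ne] := edgesP eE.
apply: le_trans (ler_wpM2r (dot_ge0 v) (local_energy_le ad eE)) _.
apply: edge_energy_bound ne (phi_proj I _) (phi_proj I _)
  (excited_ge_half I _) (excited_ge_half I _) _ v.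
by apply: secular_boundC; rewrite ?(excited_ge_half I) ?(excited_le1 I).
Qed.

Lemma eligible_step1P s s1 l lg lg' e : nonneg I s -> step1 s = (s1, lg) ->
  eligible I s1 = (l, lg') -> (e \in l) = (e \in edges I) && active s e.
Proof.
move=> nn st el; have [vE eE] := step1_same s; rewrite st /= in vE eE.
have nn1 : nonneg I s1 by rewrite /nonneg vE eE.
by have := eligibleP e nn1; rewrite el /active vE eE.
Qed.

(** At most [m] rounds update the Hamiltonian and one more finds no edge. A round costs 7 n for step
    1 and the scan, 24 for the update and 1 for control; 11 n pays for step 5. *)
Definition good_run sel m k s rho log :=
  [/\ loop I sel m.+1 k s = (Some [ffun i => Some (rho i)], log),
    (size log <= m.+1 * (7 * n + 25) + 11 * n)%N, admissible rho
    & forall v, energy rho (ham s) * dot v v <= r * dot (v *m ham s) v].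

Lemma ratio_ge0 : 0 <= r. Proof. by rewrite divr_ge0 ?ler0n. Qed.

Lemma loop_stop sel m k s s1 lg lg' : nonneg I s -> step1 s = (s1, lg) ->
  eligible I s1 = ([::], lg') -> exists rho log, good_run sel m k s rho log.
Proof.
move=> nn st el; exists (rounded s); eexists; split.
- by rewrite (loopS _ _ _ st el) (step5_out nn st).
- have arith a b c p q X : (a <= 7 * p -> b <= 7 * q -> c <= 11 * p ->
      7 * (p + q) + 25 <= X -> a + (b + (c + 0)) <= X + 11 * (p + q))%N by lia.
  rewrite !size_cat; apply: arith; rewrite ?leq_pmull //.
  + by have := size_step1 s; rewrite st.
  + by have := size_eligible s1; rewrite el.
  + exact: size_step5.
- exact: rounded_admissible.
- move=> v; rewrite energy_final // => [|e eE].
    by rewrite mul0r; apply: mulr_ge0; [exact: ratio_ge0|exact: ham_ge0].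
  by have := eligible_step1P e nn st el; rewrite in_nil eE => /esym/negbT.
Qed.

Lemma loop_spec sel m k s : nonneg I s -> (measure s <= m)%N ->
  exists rho log, good_run sel m k s rho log.
Proof.
elim: m k s => [|m IHm] k s nn ms;
  case st : (step1 s) => [s1 lg1]; case el : (eligible I s1) => [[|e0 l] lg2].
- exact: loop_stop nn st el.
(* With measure 0 there is no eligible edge, since using it would lower the measure. *)
- have := eligible_step1P e0 nn st el; rewrite mem_head => /esym/andP[eE ae].
  by have := measure_step nn eE ae; rewrite ltnNge (leq_trans ms).
- exact: loop_stop nn st el.
have [e e_def] : exists e, e = nth e0 (e0 :: l) (sel k %% size (e0 :: l))%N.
  by eexists.
have /andP[eE ae] : (e \in edges I) && active s e.
  by rewrite e_def -(eligible_step1P _ nn st el) mem_nth // ltn_mod.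
have same1 := step1_same s; rewrite st /= in same1.
have := step3_same e same1.
have sz1 := size_step1 s; rewrite st /= in sz1.
have sz2 := size_eligible s1; rewrite el /= in sz2.
have sz3 := size_step3 s1 e.
have loopE := loopS sel m.+1 k st el; rewrite -e_def in loopE.
move: (nonneg_step nn eE ae) (measure_step nn eE ae) (ham_step s eE).
move: (step3 I e s).1 (step3 I e s1) sz3 loopE => t [s' lg3] sz3 loopE.
move=> nn1 ms1 hamS same3; have [vE eE'] : same_weights t s' := same3.
have {}loopE : loop I sel m.+2 k s = ((loop I sel m.+1 k.+1 s').1,
  lg1 ++ lg2 ++ 0 :: lg3 ++ (loop I sel m.+1 k.+1 s').2) := loopE.
have nn' : nonneg I s' by rewrite /nonneg vE eE'.
have ms' : (measure s' <= m)%N by rewrite /measure vE eE' -ltnS (leq_trans ms1).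
have hamE : ham t = ham s' by rewrite /ham vE eE'.
have [rho [log [runE szl ad bnd]]] := IHm k.+1 s' nn' ms'.
exists rho; eexists; split; [by rewrite loopE runE| |exact: ad|move=> v].
- have arith a b c p q X : (a <= 7 * p -> b <= 7 * q -> c <= X + 11 * (p + q) ->
      a + (b + (24 + c).+1) <= 7 * (p + q) + 25 + X + 11 * (p + q))%N by lia.
  rewrite (mulSn m.+1) !size_cat [size (_ :: _)]/= size_cat sz3.
  by apply: arith; [exact: sz1|exact: sz2|].
rewrite hamS hamE energyD energyZ mulmxDr dotDl -scalemxAr dotZl.
apply: ratio_comb (local_bound _ ad eE) (bnd v).
by have [[/ltW]] := weightP nn eE ae.
Qed.

End Energy.

(** * Smallest eigenvalue of a Hermitian matrix *)

Section SmallestEigenvalue.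
Variable C : numClosedFieldType.

Lemma herm_eigenvalue_real n (A : 'M[C]_n) a :
  A ^t* = A -> eigenvalue A a -> a \is Num.real.
Proof.
move=> hA /eigenvalueP[v vA v0]; rewrite CrealE; apply/eqP.
apply: (mulIf (lt0r_neq0 (dot_gt0 v0))).
by rewrite -[LHS]dotZr -[RHS]dotZl -vA dot_mulmxr.
Qed.

(** The eigenvalues are the finitely many roots of the characteristic polynomial; being real they
    are comparable, so a least one exists despite the partial order. *)
Lemma exists_smallest_eigenvalue n (A : 'M[C]_n) : (0 < n)%N -> A ^t* = A ->
  exists a, smallest_eigenvalue A a.
Proof.
move=> n0 hA; have [a Aa] := eigenvalue_closed A n0.
have [rs rsE] := closed_field_poly_normal (char_poly A).
have evE b : eigenvalue A b = (b \in rs).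
  rewrite eigenvalue_root_char rsE (monicP (char_poly_monic A)) scale1r.
  by rewrite root_prod_XsubC.
have rsR b : b \in rs -> b \is Num.real.
  by rewrite -evE; apply: herm_eigenvalue_real.
suff [m m_rs m_min] : exists2 m, m \in rs & forall b, b \in rs -> m <= b.
  by exists m; split=> [|b]; rewrite evE //; apply: m_min.
have {a Aa} : rs != [::] by apply: contraTneq Aa => rs0; rewrite evE rs0.
elim: rs rsR {rsE evE} => // a [|b l] IHl rsR _.
  by exists a; rewrite ?mem_head // => c; rewrite inE => /eqP ->.
have [|//|m ml mmin] := IHl; first by move=> c cl; rewrite rsR // inE cl orbT.
have aR := rsR a (mem_head _ _); have mR : m \is Num.real by rewrite rsR // inE ml orbT.
have [am|ma] := real_leP aR mR.
  exists a; rewrite ?mem_head // => c; rewrite inE => /predU1P[->//|cl].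
  exact: le_trans am (mmin c cl).
exists m => [|c]; first by rewrite in_cons ml orbT.
by rewrite in_cons => /predU1P[->|/mmin//]; apply: ltW.
Qed.

End SmallestEigenvalue.

(** * Logged numbers *)

Section All.
Variables (C : numClosedFieldType) (P : C -> Prop).

(** A propositional analogue of [all], as [bits_le] is an existential statement. *)
Fixpoint All (s : seq C) : Prop := if s is x :: s' then P x /\ All s' else True.

Lemma All_cat s t : All s -> All t -> All (s ++ t).
Proof. by elim: s => //= x s IHs [Px Ps] Pt; split; last exact: IHs. Qed.

Lemma All_mem s x : All s -> x \in s -> P x.
Proof.
elim: s => //= y s IHs [Py Ps]; rewrite inE => /predU1P[->//|]; exact: IHs.
Qed.

Lemma All_p_for (T : eqType) (S : Type) (Q : S -> Prop) (r : seq T)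
    (body : T -> S -> prog C S) s : P 0 ->
  (forall t s, t \in r -> Q s -> Q (body t s).1 /\ All (body t s).2) ->
  Q s -> Q (p_for r body s).1 /\ All (p_for r body s).2.
Proof.
move=> P0; elim: r s => //= t r IHr s bodyQ Qs.
have [Q' A'] := bodyQ t s (mem_head _ _) Qs.
have [|Qr Ar] := IHr (body t s).1 _ Q'.
  by move=> u s' ur; apply: bodyQ; rewrite inE ur orbT.
by split=> //; split=> //; apply: All_cat.
Qed.

End All.

Section LogBits.
Variables (R : realType) (V : finType) (I : instance R V).
Local Notation C := (R[i] : numClosedFieldType).
Local Notation n := (#|V| + size (edges I))%N.
Implicit Types (s : state R V) (i j : V) (e : V * V).
Variable b : nat.
Hypothesis inb : input_bits_le I b.

Lemma cV_ratio i : ratio_le b (cV I i).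
Proof. by case: inb => cb _ _; apply: bits_ratio (cV_ge0 I i) (cb i). Qed.

Lemma cE_ratio e : e \in edges I -> ratio_le b (cE I e.1 e.2).
Proof.
by case: inb => _ eb _ /edgesP[ae _]; apply: bits_ratio (cE_ge0 ae) (eb _ _ ae).
Qed.

Lemma excitedV_ratio i : ratio_le b (excited I i)^-1.
Proof.
have [_ _ pb] := inb.
exact: ratioV (excited_gt0 I i) (bits_ratio (ltW (excited_gt0 I i)) (pb i 1 1)).
Qed.

Lemma lambda_ratio i j : ratio_le (2 * b + 1) (lambda I i j).
Proof. by apply: ratioD; apply: excitedV_ratio. Qed.

Lemma quotient_ratio e : e \in edges I ->
  ratio_le (3 * b + 1) (cE I e.1 e.2 / lambda I e.1 e.2).
Proof.
move=> eE; have -> : (3 * b + 1 = b + (2 * b + 1))%N by lia.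
apply: ratioM (cE_ratio eE) (ratioV (lambda_gt0 I _ _) (lambda_ratio _ _)).
Qed.

(* Every weight w_ij is a current c_i or an original c_ij / lambda_ij, because
   an edge is chosen at most once.  So all vertex coefficients stay integral
   combinations of these finitely many numbers. *)
Definition denominator D := [/\ (0 < D * D <= 2 ^ ((3 * b + 1) * (4 * n)))%N,
  forall i, multiple D (cV I i), forall i j, multiple D (lambda I i j),
  forall e, e \in edges I -> multiple D (cE I e.1 e.2) &
  forall e, e \in edges I -> multiple D (cE I e.1 e.2 / lambda I e.1 e.2)].

Lemma exists_denominator : exists D, denominator D.
Proof.
pose l := [seq cV I i | i <- enum V] ++ [seq (excited I i)^-1 | i <- enum V] ++
  [seq cE I e.1 e.2 | e <- edges I] ++
  [seq cE I e.1 e.2 / lambda I e.1 e.2 | e <- edges I].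
have [|D [/andP[D0 DB] Dl]] := @common_denominator C (3 * b + 1) l.
  have b3 : (b <= 3 * b + 1)%N by lia.
  move=> x; rewrite !mem_cat => /or4P[] /mapP[y yE ->].
  - exact: ratio_mono b3 (cV_ratio y).
  - exact: ratio_mono b3 (excitedV_ratio y).
  - exact: ratio_mono b3 (cE_ratio yE).
  - exact: quotient_ratio.
(* Two numbers per vertex and two per edge; squaring [D] then gives the factor 4 n in the
   exponent. *)
have szl : size l = (2 * n)%N by rewrite cardE !size_cat !size_map; lia.
exists D; split=> [|i|i j|e eE|e eE].
- rewrite muln_gt0 D0 (leq_trans (leq_mul DB DB)) //= szl -expnD.
  by rewrite leq_exp2l // -mulnDr -mulnDl.
- by apply: Dl; rewrite mem_cat map_f ?mem_enum.
- by apply: multipleD; apply: Dl;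
    rewrite !mem_cat (map_f (fun i => (excited I i)^-1)) ?orbT ?mem_enum.
- by apply: Dl; rewrite !mem_cat (map_f (fun e => cE I e.1 e.2)) ?orbT.
- apply: Dl; rewrite !mem_cat.
  by rewrite (map_f (fun e => cE I e.1 e.2 / lambda I e.1 e.2)) ?orbT.
Qed.

Variable B : nat.
(** 4 b + 3 is the cost of the nested subtraction 1 - (phi_00 - phi_11), the longest number outside
    the coefficient updates. The next bound pays for values with denominator [D * D]. *)
Hypothesis B_const : (4 * b + 3 <= B)%N.
Hypothesis B_coef : (b + (3 * b + 1) * (4 * n) + 1 <= B)%N.

Local Notation P := (@bits_le C B).

Variable D : nat.
Hypothesis denD : denominator D.

(** Edge coefficients need [D * D] because they lose w * lambda, a product of two multiples of 1/D.
    The last clause records that an active edge has never been chosen. *)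
Definition bounded s :=
  [/\ nonneg I s,
    forall i, curV s i <= cV I i /\ multiple D (curV s i) &
    forall e, e \in edges I -> [/\ curE s e <= cE I e.1 e.2,
      multiple (D * D) (curE s e) & active s e -> curE s e = cE I e.1 e.2]].

Lemma bounded_init : bounded (init I).
Proof.
case: denD => _ Dv _ De _; split=> [|i|e eE]; first exact: nonneg_init.
  by rewrite ffunE; split.
by rewrite ffunE; split=> //; apply/multiple_mull/De.
Qed.

Lemma weight_multiple s e : bounded s -> e \in edges I -> active s e ->
  multiple D (weight I s e).
Proof.
move=> [nn bv be] eE ae; have [_ wE] := weightP nn eE ae.
have [_ _ /(_ ae) ceE] := be e eE; have [_ _ _ _ Dq] := denD.
by case: wE => ->; rewrite ?ceE; [case: (bv e.1)|case: (bv e.2)|apply: Dq].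
Qed.

Lemma bounded_step3 s e : bounded s -> e \in edges I -> active s e ->
  bounded (step3 I e s).1.
Proof.
move=> bs eE ae; have mw := weight_multiple bs eE ae.
case: bs => nn bv be; have [_ ne] := edgesP eE; have [_ _ Dl _ _] := denD.
have nn' := nonneg_step nn eE ae.
have [[w0 wi wj wl] wE] := weightP nn eE ae; have [v0 e0] := nn.
move: nn'; rewrite step3_val //; move: (weight I s e) => w in w0 wi wj wl wE mw *.
move=> nn'; split=> [//|i|f fE]; rewrite ffunE.
  have [ci mi] := bv i; split.
    by rewrite (le_trans _ ci) // gerBl mulr_ge0 ?addr_ge0 // ltW.
  have [->|_] := eqVneq i e.1.
    by rewrite (negbTE ne) addr0 mulr1; apply: multipleB => //; case: (bv e.1).
  have [->|_] := eqVneq i e.2; last by rewrite addr0 mulr0 subr0.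
  by rewrite add0r mulr1; apply: multipleB => //; case: (bv e.2).
have [cf mf af] := be f fE; have l0 := lambda_gt0 I e.1 e.2; split.
- by rewrite (le_trans _ cf) // gerBl !mulr_ge0 // ltW.
- have [fe|_] := eqVneq f e; last by rewrite mulr0 subr0.
  by rewrite mulr1; apply: multipleB (multipleM _ _); rewrite // fe.
have [->|fe] := eqVneq f e; last first.
  (* Vertex coefficients only decrease, so another edge that is active now was active before. *)
  rewrite mulr0 subr0 => /and3P[]; rewrite /= !ffunE => f1 f2 f3; apply: af.
  have wpos k : 0 <= w * ((k == e.1)%:R + (k == e.2)%:R).
    by rewrite mulr_ge0 ?addr_ge0 // ltW.
  rewrite /active (lt_le_trans f1) ?gerBl //= (lt_le_trans f2) ?gerBl //=.
  by move: f3; rewrite (negbTE fe) mulr0 subr0.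
(* The chosen edge cannot be active afterwards: the attained minimum zeroes one of its three
   coefficients. *)
rewrite /active /= !ffunE !eqxx (negbTE ne) eq_sym (negbTE ne) addr0 add0r !mulr1.
move=> /and3P[]; rewrite !subr_gt0 => w1 w2 w3; case: wE => we.
- by rewrite we ltxx in w1.
- by rewrite we ltxx in w2.
- by rewrite we divfK ?gt_eqF // ltxx in w3.
Qed.

Lemma coef_bits x c : multiple (D * D) x -> 0 <= x -> x <= c -> ratio_le b c -> P x.
Proof.
case: denD => Dpos _ _ _ _ mx x0 xc /ratio_lt cb.
apply: bits_le_mono B_coef (multiple_bits Dpos mx x0 (le_lt_trans xc cb)).
Qed.

Lemma curV_bits s i : bounded s -> P (curV s i).
Proof.
move=> [[v0 _] /(_ i) [vc mv] _].
exact: coef_bits (multiple_mull D mv) (v0 i) vc (cV_ratio i).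
Qed.

Lemma curE_bits s e : bounded s -> e \in edges I -> P (curE s e).
Proof.
move=> [[_ e0] _ be] eE; have [ec me _] := be e eE.
exact: coef_bits me (e0 e eE) ec (cE_ratio eE).
Qed.

Lemma bits01 k : (k <= 1)%N -> P k%:R.
Proof. by apply: bits_nat; apply: leq_trans B_const; rewrite addn3. Qed.

Lemma bits0 : P 0. Proof. exact: (bits01 (leq0n 1)). Qed.

Lemma phi_bits i k l : P (phi I i k l).
Proof. by apply: (@bits_le_mono _ b); [move: B_const; lia|case: inb => _ _; apply]. Qed.

Lemma phiC_bits i k l : P ((1%:M - phi I i) k l).
Proof.
have [_ _ pb] := inb; rewrite !mxE; have := pb i k l.
move: (phi I i k l) => x xb.
(* [b.+1] supplies the positive bit count that [bits_nat] asks for. *)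
apply: (@bits_le_mono _ (2 * b.+1 + 1)); first by move: B_const; lia.
apply: bitsB; last exact: bits_le_mono (leqnSn b) xb.
by apply: bits_nat => //; case: (k == l).
Qed.

Lemma ket1_bits k l : P (ket1bra1 C k l).
Proof. by rewrite ket1E; apply: bits01; case: (_ && _). Qed.

Lemma log_step1 s : bounded s ->
  bounded (step1 s).1 /\ All P (step1 s).2.
Proof.
apply: All_p_for bits0 _ => i [v w o] _ bs; have b0 := bits0.
have ci := curV_bits i bs; rewrite /=; case: ifP => _; split; try exact: bs.
  by do 2 (split=> //); do ! split; exact: ket1_bits.
by do ! split.
Qed.

Lemma log_step5 s : bounded s -> All P (step5 I s).2.
Proof.
move=> bs; apply: (proj2 (All_p_for bits0 _ bs)) => i [v w o] _ {}bs.
have b0 := bits0; have ci := curV_bits i bs; rewrite /=; case: ifP => _ /=.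
  split=> //; split; first exact: ci; split; first exact: b0.
  by do ! split; try exact: phi_bits; exact: phiC_bits.
by split=> //; split.
Qed.

Lemma log_eligible s : bounded s -> All P (eligible I s).2.
Proof.
move=> bs; apply: (proj2 (@All_p_for C P _ _ (fun=> True) _ _ _ bits0 _ Logic.I)).
move=> e l eE _; split=> //; have b0 := bits0.
have := curE_bits bs eE; have := curV_bits e.1 bs; have := curV_bits e.2 bs.
by move=> c2 c1 cE /=; do ! split.
Qed.

Lemma log_step3 s e : bounded s -> e \in edges I -> active s e ->
  All P (step3 I e s).2.
Proof.
move=> bs eE ae; have lE := lambda_prog_val I e.1 e.2.
have [_ _ be] := bs; have [_ _ /(_ ae) ceE] := be e eE.
have bs' := bounded_step3 bs eE ae; have [_ ne] := edgesP eE.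
have ci' := curV_bits e.1 bs'; have cj' := curV_bits e.2 bs'.
have ce' := curE_bits bs' eE.
have lam : P (lambda I e.1 e.2).
  by apply: bits_le_mono (ratio_bits (lambda_ratio _ _)); move: B_const; lia.
have q : P (curE s e / lambda I e.1 e.2).
  rewrite ceE; apply: bits_le_mono (ratio_bits (quotient_ratio eE)).
  by move: B_const; lia.
have z i : P (phi I i 0 0 - phi I i 1 1).
  have [_ _ pb] := inb; apply: (@bits_le_mono _ (2 * b + 1)); last exact: bitsB.
  by move: B_const; lia.
have z1 i : P (1 - (phi I i 0 0 - phi I i 1 1)).
  have [_ _ pb] := inb.
  apply: (@bits_le_mono _ (2 * (2 * b + 1) + 1)); first by move: B_const; lia.
  by apply: bitsB; [apply: (@bits_nat _ _ 1) => //; lia|exact: bitsB].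
have z2 i : P (2%:R / (1 - (phi I i 0 0 - phi I i 1 1))).
  have -> : 2%:R / (1 - (phi I i 0 0 - phi I i 1 1)) = (excited I i)^-1.
    rewrite -[RHS]inv_double; congr (_ / (_ - _)).
    by rewrite -(trZE (phi_proj I i)) -trZ_progE.
  by apply: bits_le_mono (ratio_bits (excitedV_ratio i)); move: B_const; lia.
have wl : P (weight I s e * lambda I e.1 e.2).
  have [nn _ _] := bs; have [[w0 _ _ wl] _] := weightP nn eE ae.
  have [cle _ _] := be e eE; have l0 := lambda_gt0 I e.1 e.2.
  apply: coef_bits (mulr_ge0 (ltW w0) (ltW l0)) (le_trans wl cle) (cE_ratio eE).
  by apply: multipleM (weight_multiple bs eE ae) _; case: denD.
have ci := curV_bits e.1 bs; have cj := curV_bits e.2 bs; have ce := curE_bits bs eE.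
have {}ci' : P (curV s e.1 - weight I s e).
  by move: ci'; rewrite step3_val // ffunE eqxx (negbTE ne) addr0 mulr1.
have {}cj' : P (curV s e.2 - weight I s e).
  by move: cj'; rewrite step3_val // ffunE eqxx eq_sym (negbTE ne) add0r mulr1.
have {}ce' : P (curE s e - weight I s e * lambda I e.1 e.2).
  by move: ce'; rewrite step3_val // ffunE eqxx mulr1.
have p := phi_bits; have b0 := bits0.
rewrite /= in lE; move: wl ci' cj' ce'; rewrite /step3 /weight /= lE.
move=> wl ci' cj' ce'.
(* Five entries per endpoint: phi_00, phi_11, their difference, 1 minus it, and 2 divided by
   that. *)
do 10 (split; [by [exact: p|exact: z|exact: z1|exact: z2]|]).
split; first exact: lam.
do 3 (split; [by [exact: ci|exact: cj|exact: ce]|]).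
split; first exact: q.
do 2 (split; first exact: b0).
do 2 (split; first exact: ci').
do 2 (split; first exact: cj').
split; first exact: wl.
by do 2 (split; first exact: ce').
Qed.

Lemma log_loop sel f k s : bounded s -> All P (loop I sel f k s).2.
Proof.
elim: f k s => [|f IHf] k s bs; first exact: Logic.I.
case st : (step1 s) => [s1 lg1]; case el : (eligible I s1) => [l lg2].
have [bs1 ok1] := log_step1 bs; rewrite st in bs1 ok1.
have ok2 := log_eligible bs1; rewrite el in ok2.
rewrite (loopS _ _ _ st el); case: l el ok2 => [|e0 l] el ok2.
  apply: All_cat ok1 (All_cat ok2 (All_cat (log_step5 bs1) _)); exact: Logic.I.
have [e e_def] : exists e, e = nth e0 (e0 :: l) (sel k %% size (e0 :: l))%N.
  by eexists.
rewrite -e_def; have nn : nonneg I s1 by case: bs1.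
have /andP[eE ae] : (e \in edges I) && active s1 e.
  have := eligibleP e nn; rewrite el => <-.
  by rewrite e_def mem_nth // ltn_mod.
have bs3 := bounded_step3 bs1 eE ae.
apply: All_cat ok1 (All_cat ok2 _); split; first exact: bits0.
by apply: All_cat (log_step3 bs1 eE ae) (IHf _ _ bs3).
Qed.

End LogBits.

(** * Polynomial budgets and the approximation theorem *)

Lemma log_bits (R : realType) (V : finType) (I : instance R V) sel f (b B : nat)
    (n := (#|V| + size (edges I))%N) : input_bits_le I b ->
  (4 * b + 3 <= B)%N -> (b + (3 * b + 1) * (4 * n) + 1 <= B)%N ->
  forall x, x \in (loop I sel f 0 (init I)).2 -> bits_le B x.
Proof.
move=> inb B1 B2 x; have [D denD] := exists_denominator inb.
exact: All_mem (log_loop inb B1 B2 denD sel f 0 (bounded_init denD)).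
Qed.

Lemma bits_budget_const t u : (4 * u + 3 <= 64 * ((t + u + 2) * (t + u + 2)))%N.
Proof. by rewrite !mulnDl !mulnDr; lia. Qed.

Lemma bits_budget_coef t u :
  (u + (3 * u + 1) * (4 * t) + 1 <= 64 * ((t + u + 2) * (t + u + 2)))%N.
Proof.
(* Both sides are expanded into monomials, which the closing [lia] treats as atoms. *)
have -> : ((3 * u + 1) * (4 * t) = 12 * (u * t) + 4 * t)%N by lia.
have -> : (64 * ((t + u + 2) * (t + u + 2)) = 64 * (t * t) + 64 * (u * u) +
    128 * (u * t) + 256 * t + 256 * u + 256)%N by lia.
lia.
Qed.

Theorem theorem6 (R : realType) :
  exists k : nat,
    forall (V : finType) (I : instance R V) (sel : nat -> nat),
    exists (rho : V -> 'M[R[i]]_2) (log : seq R[i]),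
      [/\ run I sel rho log,
          (size log <= (#|V| + size (edges I) + 2) ^ k)%N,
          forall b : nat, input_bits_le I b ->
            forall x, x \in log ->
              bits_le ((#|V| + size (edges I) + b + 2) ^ k)%N x,
          forall i, is_density (rho i)
        & exists lam : R[i],
            smallest_eigenvalue (hamiltonian I) lam /\
            \tr (hamiltonian I *m tensor rho) <= 4194%:R / 1000%:R * lam].
Proof.
(* Time and bit length are both at most 64 t^2 with t >= 2, and 64 = 2^6 <= t^6. *)
exists 8%N => V I sel.
set n := (#|V| + size (edges I))%N.
have pow8 t : (1 < t)%N -> (64 * (t * t) <= t ^ 8)%N.
  move=> t1; rewrite (expnD t 6 2) -(expn1 t) -expnD expn1 leq_mul2r.
  by rewrite (leq_exp2r 2 t (isT : 0 < 6)%N) t1 orbT.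
have ms : (measure I (init I) <= n)%N.
  by rewrite leq_add // ?cardE count_size.
have [rho [log [runE szl ad bnd]]] := loop_spec sel 0 (nonneg_init I) ms.
exists rho, log; split.
- by exists n.+1.
- have arith t : (t.+1 * (7 * t + 25) + 11 * t <= 64 * ((t + 2) * (t + 2)))%N by nia.
  by apply: leq_trans szl (leq_trans (arith n) (pow8 _ _)); rewrite addn2.
- move=> b inb x x_log.
  have le8 := pow8 (n + b + 2)%N; rewrite {1}addn2 in le8.
  apply: (log_bits (sel := sel) (f := n.+1) inb).
  + exact: leq_trans (bits_budget_const n b) (le8 isT).
  + exact: leq_trans (bits_budget_coef n b) (le8 isT).
  + by rewrite runE.
- move=> i; case: (ad i) => ->; apply: is_density_proj.
  + exact: ket1_adj.
  + exact: ket1_idem.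
  + exact: tr_ket1.
  + exact: projC_adj (phi_proj I i).
  + exact: projC_idem (phi_proj I i).
  + exact: tr_projC (phi_proj I i).
have card0 : (0 < #|basis V|)%N.
  by rewrite card_ffun card_ord expn_gt0.
have [lam lamP] := exists_smallest_eigenvalue card0 (ham_adj (nonneg_init I)).
exists lam; rewrite ham_init; split=> //.
(* On a ground state v the quadratic form is lam |v|^2, and the positive factor |v|^2 cancels. *)
have [/eigenvalueP[v vH v0] _] := lamP.
have := bnd v; rewrite vH dotZl mulrA ler_pM2r ?dot_gt0 //.
Qed.
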